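(* Let $(M,\phi,\xi,\eta,g)$ be a $(2n+1)$-dimensional Sasakian manifold that is $\phi$-projectively flat and admits a $*$-Conformal $\eta$-Ricci soliton with data $\lambda,\mu,p$. Then $\mu=1$ and $\lambda=\frac12\left(p+\frac{2}{2n+1}\right)-1$.
   Context: Conventions. $\chi(M)$ is the space of smooth vector fields on $M$; $\nabla$ is the Levi-Civita connection of $g$; $R(X,Y)Z=\nabla_X\nabla_YZ-\nabla_Y\nabla_XZ-\nabla_{[X,Y]}Z$; $S(Y,Z)=\mathrm{trace}\{X\mapsto R(X,Y)Z\}$ is the Ricci tensor; $Q$ is the Ricci operator, $S(X,Y)=g(QX,Y)$. Sasakian manifold. An almost contact metric structure on a connected $(2n+1)$-dimensional manifold $M$ ($n\ge 1$) consists of a $(1,1)$-tensor field $\phi$, a vector field $\xi$, a 1-form $\eta$ and a Riemannian metric $g$ with $\phi^2X=-X+\eta(X)\xi$, $\eta(\xi)=1$, $\eta\circ\phi=0$, $\phi\xi=0$, $g(\phi X,\phi Y)=g(X,Y)-\eta(X)\eta(Y)$, $g(X,\phi Y)=-g(\phi X,Y)$, $g(X,\xi)=\eta(X)$. It is a contact metric structure if $d\eta(X,Y)=g(X,\phi Y)$, and it is normal if $2d\eta(X,Y)\xi+[\phi,\phi](X,Y)=0$, where $[\phi,\phi](X,Y)=\phi^2[X,Y]+[\phi X,\phi Y]-\phi[\phi X,Y]-\phi[X,\phi Y]$ and $d\eta(X,Y)=\frac12\big(X\eta(Y)-Y\eta(X)-\eta([X,Y])\big)$. A Sasakian manifold is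 a normal contact metric manifold; with these conventions $\nabla_X\xi=-\phi X$. Soliton. The $*$-Ricci tensor is $S^*(X,Y)=\frac12\,\mathrm{trace}\{\phi\circ R(X,\phi Y)\}$. $M$ admits a $*$-Conformal $\eta$-Ricci soliton (with data $\lambda,\mu,p$) if $\mathcal{L}_\xi g+2S^*+\left[2\lambda-\left(p+\frac{2}{2n+1}\right)\right]g+2\mu\,\eta\otimes\eta=0$, where $\mathcal{L}_\xi$ is the Lie derivative along $\xi$, $\lambda,\mu$ are real constants and $p$ is a (smooth) scalar field. The projective curvature tensor of the $(2n+1)$-dimensional manifold $M$ is, in this paper, $P(X,Y)Z=R(X,Y)Z-\frac{1}{2n}[g(Y,Z)QX-g(X,Z)QY]$. $M$ (of dimension greater than $3$) is $\phi$-projectively flat if $\phi^2\big(P(\phi X,\phi Y)\phi Z\big)=0$ for all $X,Y,Z\in\chi(M)$. *)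

(* Defs.v *)
From HB Require Import structures.
From mathcomp Require Export all_boot all_order all_algebra.
From mathcomp Require Export all_classical all_reals all_analysis.
Export Order.TTheory GRing.Theory Num.Theory numFieldNormedType.Exports.

Set Implicit Arguments.
Unset Strict Implicit.
Unset Printing Implicit Defensive.

Local Open Scope classical_set_scope.
Local Open Scope ring_scope.

Section Smooth.
Context {R : realType} {V W : normedModType R}.

(* f is k times continuously differentiable on the set U, meant for open U and
   finite-dimensional V. *)
Fixpoint C_on (k : nat) (U : set V) (f : V -> W) : Prop :=
  if k is k'.+1 then
    (forall a, U a -> differentiable f a) /\
    (forall v : V, C_on k' U (fun a => 'D_v f a))
  else forall a, U a -> {for a, continuous f}.

Definition smooth_on (U : set V) (f : V -> W) : Prop := forall k, C_on k U f.

End Smooth.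

(* Smooth m-manifolds without boundary, given by an arbitrary (not necessarily
   maximal) smooth atlas.  [chart_inv i] is only meaningful on the image of
   chart i, and [coord i] only on its domain.  [chart_at] selects, at each point, a chart
   around it; it serves below to represent tangent vectors. *)
Record manifold (R : realType) (m : nat) := Manifold {
  point_of :> topologicalType;
  manifold_hausdorff : hausdorff_space point_of;
  manifold_second_countable : @second_countable point_of;
  chart : Type;
  dom : chart -> set point_of;
  coord : chart -> point_of -> 'rV[R]_m;
  chart_inv : chart -> 'rV[R]_m -> point_of;
  chart_at : point_of -> chart;
  chart_atP : forall x, dom (chart_at x) x;
  dom_open : forall i, open (dom i);
  img_open : forall i, open (coord i @` dom i);
  coordK : forall i x, dom i x -> chart_inv i (coord i x) = x;
  coord_cont : forall i x, dom i x -> {for x, continuous (coord i)};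
  inv_cont : forall i a, (coord i @` dom i) a ->
    {for a, continuous (chart_inv i)};
  transition_smooth : forall i j,
    smooth_on (coord i @` (dom i `&` dom j)) (coord j \o chart_inv i)
}.

Section Manifold.
Context {R : realType} {m : nat} {M : manifold R m}.

Definition img (i : chart M) : set 'rV[R]_m := coord i @` dom i.

Definition smooth_fun (f : M -> R) : Prop :=
  forall i : chart M, smooth_on (img i) (f \o chart_inv i).

(* The tangent space at x is identified with R^m by means of the coordinate
   frame of the chart [chart_at x] at x.  A vector field is thus a map
   X : M -> 'rV[R]_m where X x lists the components of the tangent vector at x in
   the chart [chart_at x]; the components in another chart around x are
   obtained by applying the differential of the transition map. *)
Definition vfield : Type := M -> 'rV[R]_m.

Definition comp_in (i : chart M) (X : vfield) : vfield := fun x =>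
  'D_(X x) (coord i \o chart_inv (chart_at x)) (coord (chart_at x) x).

Definition smooth_vfield (X : vfield) : Prop :=
  forall i : chart M, smooth_on (img i) (comp_in i X \o chart_inv i).

Definition dirder (X : vfield) (f : M -> R) : M -> R := fun x =>
  'D_(X x) (f \o chart_inv (chart_at x)) (coord (chart_at x) x).

Definition bracket (X Y : vfield) : vfield := fun x =>
  let i := chart_at x in
  'D_(X x) (comp_in i Y \o chart_inv i) (coord i x)
  - 'D_(Y x) (comp_in i X \o chart_inv i) (coord i x).

Definition scalef (f : M -> R) (X : vfield) : vfield := fun x => f x *: X x.

(* Tensor fields are families of matrices in the frames of [chart_at x], acting
   on row vectors: phi_x(u) = u *m phi x, eta_x(u) = u *m eta x and
   g_x(u, v) = u *m g x *m v^T. *)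
Definition endo_at (phi : M -> 'M[R]_m) (x : M) (u : 'rV[R]_m) : 'rV[R]_m :=
  u *m phi x.
Definition form_at (eta : M -> 'cV[R]_m) (x : M) (u : 'rV[R]_m) : R :=
  (u *m eta x) 0 0.
Definition met_at (g : M -> 'M[R]_m) (x : M) (u v : 'rV[R]_m) : R :=
  (u *m g x *m v^T) 0 0.

Definition endo (phi : M -> 'M[R]_m) (X : vfield) : vfield :=
  fun x => endo_at phi x (X x).
Definition form (eta : M -> 'cV[R]_m) (X : vfield) : M -> R :=
  fun x => form_at eta x (X x).
Definition met (g : M -> 'M[R]_m) (X Y : vfield) : M -> R :=
  fun x => met_at g x (X x) (Y x).

Definition smooth_endo (phi : M -> 'M[R]_m) : Prop :=
  forall X, smooth_vfield X -> smooth_vfield (endo phi X).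
Definition smooth_form (eta : M -> 'cV[R]_m) : Prop :=
  forall X, smooth_vfield X -> smooth_fun (form eta X).

Definition riemannian_metric (g : M -> 'M[R]_m) : Prop :=
  [/\ forall X Y, smooth_vfield X -> smooth_vfield Y -> smooth_fun (met g X Y),
      forall x u v, met_at g x u v = met_at g x v u
    & forall x u, u != 0 -> 0 < met_at g x u u].

(* [nabla X Y] is the covariant derivative of Y along X. *)
Record levi_civita (g : M -> 'M[R]_m) (nabla : vfield -> vfield -> vfield)
    : Prop := LeviCivita {
  nabla_smooth : forall X Y, smooth_vfield X -> smooth_vfield Y ->
    smooth_vfield (nabla X Y);
  nabla_addl : forall X Y Z,
    smooth_vfield X -> smooth_vfield Y -> smooth_vfield Z ->
    nabla (X \+ Y) Z = nabla X Z \+ nabla Y Z;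
  nabla_scalel : forall f X Y,
    smooth_fun f -> smooth_vfield X -> smooth_vfield Y ->
    nabla (scalef f X) Y = scalef f (nabla X Y);
  nabla_addr : forall X Y Z,
    smooth_vfield X -> smooth_vfield Y -> smooth_vfield Z ->
    nabla X (Y \+ Z) = nabla X Y \+ nabla X Z;
  nabla_leibniz : forall f X Y,
    smooth_fun f -> smooth_vfield X -> smooth_vfield Y ->
    nabla X (scalef f Y) = scalef (dirder X f) Y \+ scalef f (nabla X Y);
  nabla_torsion_free : forall X Y, smooth_vfield X -> smooth_vfield Y ->
    nabla X Y \- nabla Y X = bracket X Y;
  nabla_metric : forall X Y Z,
    smooth_vfield X -> smooth_vfield Y -> smooth_vfield Z ->
    dirder X (met g Y Z) = met g (nabla X Y) Z \+ met g Y (nabla X Z)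
}.

(* The trace at x of a C^oo(M)-linear map T of vector fields: such a T acts
   pointwise, and the set below is the singleton of the matrix of T_x. *)
Definition trace_field (T : vfield -> vfield) : M -> R := fun x =>
  \tr (xget 0 [set A : 'M[R]_m |
    forall X, smooth_vfield X -> T X x = X x *m A]).

Section Curvature.
Context (g : M -> 'M[R]_m) (nabla : vfield -> vfield -> vfield).

Definition curvature (X Y Z : vfield) : vfield :=
  nabla X (nabla Y Z) \- nabla Y (nabla X Z) \- nabla (bracket X Y) Z.

Definition ricci (Y Z : vfield) : M -> R :=
  trace_field (fun X => curvature X Y Z).

(* The metric dual of the Ricci tensor: S(X, Y) = g(QX, Y). *)
Definition ricci_operator (X : vfield) : vfield := fun x =>
  xget 0 [set v : 'rV[R]_m |
    forall Y, smooth_vfield Y -> ricci X Y x = met_at g x v (Y x)].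

Definition star_ricci (phi : M -> 'M[R]_m) (X Y : vfield) : M -> R := fun x =>
  2^-1 * trace_field (fun Z => endo phi (curvature X (endo phi Y) Z)) x.

End Curvature.

Definition lie_metric (g : M -> 'M[R]_m) (xi X Y : vfield) : M -> R := fun x =>
  dirder xi (met g X Y) x - met g (bracket xi X) Y x - met g X (bracket xi Y) x.

Definition d_form (eta : M -> 'cV[R]_m) (X Y : vfield) : M -> R := fun x =>
  2^-1 * (dirder X (form eta Y) x - dirder Y (form eta X) x
          - form eta (bracket X Y) x).

Definition nijenhuis (phi : M -> 'M[R]_m) (X Y : vfield) : vfield := fun x =>
  endo phi (endo phi (bracket X Y)) x + bracket (endo phi X) (endo phi Y) x
  - endo phi (bracket (endo phi X) Y) x - endo phi (bracket X (endo phi Y)) x.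

End Manifold.

Arguments vfield {R m} M.

Section Sasakian.
Context {R : realType} {n : nat} {M : manifold R (2 * n).+1}.
Local Notation dim := (2 * n).+1.
Implicit Types (phi g : M -> 'M[R]_dim) (xi : vfield M) (eta : M -> 'cV[R]_dim).

(* [connected] holds of the empty set, hence the nonemptiness condition. *)
Record almost_contact_metric phi xi eta g : Prop := AlmostContactMetric {
  acm_dim : (1 <= n)%N;
  acm_nonempty : [set: M] !=set0;
  acm_connected : connected [set: M];
  acm_phi_smooth : smooth_endo phi;
  acm_xi_smooth : smooth_vfield xi;
  acm_eta_smooth : smooth_form eta;
  acm_metric : riemannian_metric g;
  acm_phi2 : forall x u,
    endo_at phi x (endo_at phi x u) = - u + form_at eta x u *: xi x;
  acm_eta_xi : forall x, form_at eta x (xi x) = 1;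
  acm_eta_phi : forall x u, form_at eta x (endo_at phi x u) = 0;
  acm_phi_xi : forall x, endo_at phi x (xi x) = 0;
  acm_compat : forall x u v,
    met_at g x (endo_at phi x u) (endo_at phi x v)
    = met_at g x u v - form_at eta x u * form_at eta x v;
  acm_skew : forall x u v,
    met_at g x u (endo_at phi x v) = - met_at g x (endo_at phi x u) v;
  acm_eta_dual : forall x u, met_at g x u (xi x) = form_at eta x u
}.

Definition contact_metric phi xi eta g : Prop :=
  almost_contact_metric phi xi eta g /\
  forall X Y, smooth_vfield X -> smooth_vfield Y ->
    d_form eta X Y = met g X (endo phi Y).

Definition normal_structure phi xi eta : Prop :=
  forall X Y, smooth_vfield X -> smooth_vfield Y -> forall x,
    (2 * d_form eta X Y x) *: xi x + nijenhuis phi X Y x = 0.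

Definition sasakian phi xi eta g : Prop :=
  contact_metric phi xi eta g /\ normal_structure phi xi eta.

Definition star_conformal_eta_ricci_soliton phi xi eta g
    (nabla : vfield M -> vfield M -> vfield M)
    (lambda mu : R) (p : M -> R) : Prop :=
  smooth_fun p /\
  forall X Y, smooth_vfield X -> smooth_vfield Y -> forall x,
    lie_metric g xi X Y x + 2 * star_ricci nabla phi X Y x
    + (2 * lambda - (p x + 2 / (2 * n + 1)%:R)) * met g X Y x
    + 2 * mu * (form eta X x * form eta Y x) = 0.

Definition projective_curvature g (nabla : vfield M -> vfield M -> vfield M)
    (X Y Z : vfield M) : vfield M := fun x =>
  curvature nabla X Y Z x
  - (2 * n)%:R^-1 *: (met g Y Z x *: ricci_operator g nabla X x
                      - met g X Z x *: ricci_operator g nabla Y x).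

Definition phi_projectively_flat phi g
    (nabla : vfield M -> vfield M -> vfield M) : Prop :=
  (3 < 2 * n + 1)%N /\
  forall X Y Z, smooth_vfield X -> smooth_vfield Y -> smooth_vfield Z ->
    forall x, endo phi (endo phi
      (projective_curvature g nabla (endo phi X) (endo phi Y) (endo phi Z))) x
      = 0.

End Sasakian.

(* Main.v *)
(* By tensoriality everything is decided at a point.  The contact and normality
   conditions, together with the Jacobi identity, make xi a Killing field with
   nabla_X xi = - phi X and determine nabla phi; hence R(X, Y) xi = 0 and
   R(xi, X) xi = - X for X, Y orthogonal to xi.  On the contact distribution D,
   phi-projective flatness then reads
     R(X, Y) Z = (g(Y, Z) QX - g(X, Z) QY) / 2n   modulo xi,
   and the trace over X gives S = k g on D for a scalar k; taking the trace once
   more forces k = 2n, so R is of constant curvature 1 on D.  Therefore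
   S*(X, X) = g(X, X) for X in D, while S*(xi, xi) = 0.  As L_xi g = 0, the soliton
   equation at a nonzero X in D yields lambda, and at xi it yields mu. *)

From HB Require Import structures.
From mathcomp Require Import ring lra.
Require Import Defs.

Set Implicit Arguments.
Unset Strict Implicit.
Unset Printing Implicit Defensive.

Local Open Scope classical_set_scope.
Local Open Scope ring_scope.

(** * Smooth maps between normed spaces *)

(** The hypotheses speak of global smooth fields, whereas the argument lives at one point. Two facts
    link them: cutoff functions extend every tangent vector to a global smooth field, and a map
    linear over smooth functions is a matrix at each point, so that traces become matrix algebra.
    Tangent vectors are rows in the frame of [chart_at x], a choice that need not vary continuously
    with x; derivatives are therefore taken in a chart held fixed. Horizontal fields are always
    written [endo phi X]: these are smooth, and at a point they reach all of D because phi^2 = -1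
    there. The value k = 2n is due to the xi direction. With N = 2n, the trace over D alone would
    give k = (k N - k) / N, hence k = 0; the planes containing xi have curvature 1 and add 1 to the
    right-hand side, hence k = N. *)

Section Calculus.
Context {R : realType}.
Implicit Types V W : normedModType R.

Lemma near_open_eq (T : topologicalType) S (U : set T) (f g : T -> S) (a : T) :
  open U -> U a -> {in U, f =1 g} -> \near a, f a = g a.
Proof.
move=> oU Ua fg; have := open_nbhs_nbhs (conj oU Ua); apply: filterS => b Ub.
by apply: fg; rewrite inE.
Qed.

(** The little-o expansion of f at a involves only values near a, so the differential of f also
    serves as that of g. *)
Lemma differentiable_near_eq V W (f g : V -> W) (a : V) :
  (\near a, f a = g a) -> differentiable f a -> differentiable g a.
Proof.
move=> fg /diff_locallyP[cf df]; have fga := nbhs_singleton fg.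
have E : g \o shift a = cst (g a) + 'd f a +o_ 0 id.
  apply/eqaddoP => e e0.
  move/eqaddoP: df => /(_ e e0).
  have : \forall h \near (0 : V), f (h + a) = g (h + a).
    by move: fg; rewrite [X in X -> _](near_shift 0) subr0.
  by apply: filterS2 => h /= fgh; rewrite /= !fctE /= fgh fga.
by apply/diff_locallyP; rewrite (diff_unique cf E).
Qed.

Lemma derive_addv V W (f : V -> W) a u v : differentiable f a ->
  'D_(u + v) f a = 'D_u f a + 'D_v f a.
Proof. by move=> df; rewrite !deriveE // linearD. Qed.

Lemma derive_scalev V W (f : V -> W) a (c : R) v : differentiable f a ->
  'D_(c *: v) f a = c *: 'D_v f a.
Proof. by move=> df; rewrite !deriveE // linearZ. Qed.

(** Derivatives at a point see a neighbourhood of it, hence the open U. Through this lemma the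
    formulas for derivatives below need to hold on U only. *)
Lemma C_on_ext V W k (U : set V) (f g : V -> W) :
  open U -> {in U, f =1 g} -> C_on k U f -> C_on k U g.
Proof.
move=> oU; elim: k f g => [|k IH] f g fg /=.
  move=> cf a Ua; have nfg := near_open_eq oU Ua fg.
  rewrite /prop_for /continuous_at -(nbhs_singleton nfg).
  apply: cvg_trans (cf a Ua); exact: near_eq_cvg.
move=> [df Df]; split=> [a Ua|v].
  exact: differentiable_near_eq (near_open_eq oU Ua fg) (df a Ua).
apply: IH (Df v) => a; rewrite inE => Ua.
exact: near_eq_derive (near_open_eq oU Ua fg).
Qed.

Lemma C_on_setU V W k (U1 U2 : set V) (f : V -> W) :
  C_on k U1 f -> C_on k U2 f -> C_on k (U1 `|` U2) f.
Proof.
elim: k f => [|k IH] f /=; first by move=> c1 c2 a [/c1|/c2].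
move=> [d1 D1] [d2 D2]; split=> [a [/d1|/d2] //|v].
by apply: IH; [exact: D1|exact: D2].
Qed.

Lemma C_on_sub V W k (U U' : set V) (f : V -> W) :
  U' `<=` U -> C_on k U f -> C_on k U' f.
Proof.
move=> sU; elim: k f => [|k IH] f /=; first by move=> cf a /sU; exact: cf.
by move=> [df Df]; split=> [a /sU|v]; [exact: df|exact: IH (Df v)].
Qed.

Lemma C_onS V W k (U : set V) (f : V -> W) : C_on k.+1 U f -> C_on k U f.
Proof.
elim: k f => [|k IH] f /=.
  by move=> [df _] a Ua; apply: differentiable_continuous; exact: df.
by move=> [df Df]; split=> // v; apply: IH; exact: (Df v).
Qed.

Lemma C_on_cst V W k (U : set V) (w : W) : C_on k U (cst w).
Proof.
elim: k w => [|k IH] w /=; first by move=> a _; exact: cst_continuous.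
split=> [a _|v]; first exact: differentiable_cst.
have -> : (fun a => 'D_v (cst w) a) = cst 0 :> (V -> W).
  by apply/funext => a; rewrite derive_cst.
exact: IH.
Qed.

Lemma C_on_add V W k (U : set V) (f g : V -> W) : open U ->
  C_on k U f -> C_on k U g -> C_on k U (f \+ g).
Proof.
move=> oU; elim: k f g => [|k IH] f g /=.
  by move=> cf cg a Ua; apply: continuousD; [exact: cf|exact: cg].
move=> [df Df] [dg Dg]; split=> [a Ua|v].
  by apply: differentiableD; [exact: df|exact: dg].
apply: C_on_ext oU _ (IH _ _ (Df v) (Dg v)) => a; rewrite inE => Ua /=.
by rewrite -deriveD //; apply: diff_derivable; [exact: df|exact: dg].
Qed.

Lemma C_on_sum V W k (U : set V) I (s : seq I) (f : I -> V -> W) : open U ->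
  (forall i, C_on k U (f i)) -> C_on k U (fun a => \sum_(i <- s) f i a).
Proof.
move=> oU H; elim: s => [|i s IH].
  by apply: C_on_ext oU _ (C_on_cst k U 0) => a _; rewrite big_nil.
by apply: C_on_ext oU _ (C_on_add oU (H i) IH) => a _; rewrite big_cons.
Qed.

Lemma C_on_mul V k (U : set V) (f g : V -> R) : open U ->
  C_on k U f -> C_on k U g -> C_on k U (f \* g).
Proof.
move=> oU; elim: k f g => [|k IH] f g /=.
  by move=> cf cg a Ua; apply: continuousM; [exact: cf|exact: cg].
move=> Cf Cg; have [[df Df] [dg Dg]] := (Cf, Cg); split=> [a Ua|v].
  by apply: differentiableM; [exact: df|exact: dg].
have C1 := IH _ _ (C_onS Cf) (Dg v); have C2 := IH _ _ (C_onS Cg) (Df v).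
apply: C_on_ext oU _ (C_on_add oU C1 C2) => a; rewrite inE => Ua /=.
by rewrite deriveM //; apply: diff_derivable; [exact: df|exact: dg].
Qed.

Lemma C_on_lin V W W' k (U : set V) (f : V -> W) (L : {linear W -> W'}) :
  open U -> continuous L -> C_on k U f -> C_on k U (L \o f).
Proof.
move=> oU cL; elim: k f => [|k IH] f /=.
  by move=> cf a Ua; apply: continuous_comp; [exact: cf|exact: cL].
move=> [df Df]; have dL b : differentiable L b by exact: linear_differentiable.
split=> [a Ua|v]; first by apply: differentiable_comp => //; exact: df.
apply: C_on_ext oU _ (IH _ (Df v)) => a; rewrite inE => Ua /=.
have dfa := df _ Ua; rewrite !deriveE //; last exact: differentiable_comp.
rewrite (diff_comp dfa (dL _)) /=.
by rewrite (diff_lin _ cL).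
Qed.

End Calculus.

(** * Coordinates and the chain rule for C^k maps *)

Section Coordinates.
Context {R : realType}.
Implicit Types V W : normedModType R.

Lemma row_coord_is_linear m (j : 'I_m) :
  linear (fun v : 'rV[R]_m => v 0 j : R).
Proof. by move=> c u v; rewrite !mxE. Qed.

Lemma C_on_coord V m k (U : set V) (f : V -> 'rV[R]_m) j : open U ->
  C_on k U f -> C_on k U (fun a => f a 0 j).
Proof.
move=> oU; pose Lj : {linear 'rV[R]_m -> R} := HB.pack
  (fun v : 'rV[R]_m => v 0 j : R)
  (GRing.isLinear.Build _ _ _ _ _ (row_coord_is_linear j)).
apply: (@C_on_lin _ _ _ _ _ _ _ Lj) => //; exact: coord_continuous.
Qed.

Lemma scale_vec_is_linear W (w : W) : linear (fun c : R => c *: w).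
Proof. by move=> c u v; rewrite scalerDl scalerA. Qed.

Lemma C_on_scale_vec V W k (U : set V) (f : V -> R) (w : W) : open U ->
  C_on k U f -> C_on k U (fun a => f a *: w).
Proof.
move=> oU; pose L : {linear R -> W} := HB.pack (fun c : R => c *: w)
  (GRing.isLinear.Build _ _ _ _ _ (scale_vec_is_linear w)).
apply: (@C_on_lin _ _ _ _ _ _ _ L) => //; exact: scalel_continuous.
Qed.

Lemma C_on_row V m k (U : set V) (f : V -> 'rV[R]_m) : open U ->
  (forall j, C_on k U (fun a => f a 0 j)) -> C_on k U f.
Proof.
move=> oU H.
have Hj j : C_on k U (fun a => f a 0 j *: (delta_mx 0 j : 'rV[R]_m)).
  exact: C_on_scale_vec.
apply: C_on_ext oU _ (C_on_sum (index_enum 'I_m) oU Hj) => a _.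
by rewrite /= [RHS]row_sum_delta.
Qed.

Lemma C_on_scale V m k (U : set V) (f : V -> R) (g : V -> 'rV[R]_m) : open U ->
  C_on k U f -> C_on k U g -> C_on k U (fun a => f a *: g a).
Proof.
move=> oU Cf Cg; apply: C_on_row => // j.
apply: C_on_ext oU _ (C_on_mul oU Cf (C_on_coord j oU Cg)) => a _ /=.
by rewrite mxE.
Qed.

Lemma derive_sum_coord W m (g : 'rV[R]_m -> W) (b v : 'rV[R]_m) :
  differentiable g b ->
  'D_v g b = \sum_j v 0 j *: 'D_(delta_mx 0 j) g b.
Proof.
move=> dg; rewrite deriveE // [in LHS](row_sum_delta v) linear_sum.
by apply: eq_bigr => j _; rewrite linearZ /= deriveE.
Qed.

Lemma derive_comp V (V' : normedModType R) W (f : V -> V') (g : V' -> W) a v :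
  differentiable f a -> differentiable g (f a) ->
  'D_v (g \o f) a = 'D_('D_v f a) g (f a).
Proof.
move=> df dg; rewrite !deriveE //; last exact: differentiable_comp.
by rewrite diff_comp.
Qed.

(** [C_on] differentiates in fixed directions, while the chain rule differentiates g along the
    moving vector ['D_v f a]. Expanding that vector in coordinates leaves fixed directions with
    scalar coefficients, to which the product lemma and the induction apply. *)
Lemma C_on_comp_real V m k (U : set V) (U' : set 'rV[R]_m)
    (f : V -> 'rV[R]_m) (g : 'rV[R]_m -> R) : open U ->
  (forall a, U a -> U' (f a)) ->
  C_on k U f -> C_on k U' g -> C_on k U (g \o f).
Proof.
move=> oU fU; elim: k g => [|k IH] g.
  by move=> /= cf cg a Ua; apply: continuous_comp; [exact: cf|exact: (cg _ (fU _ Ua))].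
move=> Cf [dg Dg]; have [df Df] := Cf; split=> [a Ua|v].
  by apply: differentiable_comp; [exact: df|apply: dg; exact: fU].
have H j : C_on k U (fun a => ('D_v f a) 0 j * 'D_(delta_mx 0 j) g (f a)).
  apply: C_on_mul => //; first exact: C_on_coord (Df v).
  exact: (IH (fun b => 'D_(delta_mx 0 j) g b) (C_onS Cf) (Dg _)).
apply: C_on_ext oU _ (C_on_sum (index_enum 'I_m) oU H) => a; rewrite inE => Ua.
have dga := dg _ (fU _ Ua).
by rewrite /= (derive_comp _ (df _ Ua) dga) derive_sum_coord.
Qed.

Lemma C_on_comp V m m' k (U : set V) (U' : set 'rV[R]_m)
    (f : V -> 'rV[R]_m) (g : 'rV[R]_m -> 'rV[R]_m') : open U -> open U' ->
  (forall a, U a -> U' (f a)) ->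
  C_on k U f -> C_on k U' g -> C_on k U (g \o f).
Proof.
move=> oU oU' fU Cf Cg; apply: C_on_row => // j.
exact: (C_on_comp_real oU fU Cf (C_on_coord j oU' Cg)).
Qed.

End Coordinates.

(** * Symmetry of second derivatives *)

Section Schwarz.
Context {R : realType} {V : normedModType R}.

Lemma is_derive_line (f : V -> R) (u c : V) (s : R) :
  differentiable f (s *: u + c) ->
  is_derive s 1 (fun s => f (s *: u + c)) ('D_u f (s *: u + c)).
Proof.
move=> df.
have [dd dE] : is_diff s (fun s : R => s *: u + c) ( *:%R^~ u).
  have := is_diffD (is_diff_scalel s u) (is_diff_cst c s).
  by rewrite addr0.
apply: DeriveDef; first by apply/diff_derivable/(differentiable_comp dd).
by rewrite (derive_comp _ dd df) [X in 'D_X _ _]deriveE // dE scale1r.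
Qed.

Lemma MVT_derivable (f df : R -> R) (a b : R) : a <= b ->
  (forall x, a <= x <= b -> is_derive x 1 f (df x)) ->
  exists2 c, a <= c <= b & f b - f a = df c * (b - a).
Proof.
move=> ab dfx; have [| |c cab E] := @MVT_segment R f df a b ab.
- by move=> x; rewrite in_itv /= => /andP[/ltW ax /ltW xb]; apply: dfx; rewrite ax.
- apply/continuous_in_subspaceT => x; rewrite inE /= in_itv /= => xab.
  by have [dx _] := dfx _ xab; exact/differentiable_continuous/derivable1_diffP.
by exists c => //; move: cab; rewrite in_itv.
Qed.

(** Two mean value theorems: along u for the increment of f under the shift by [h *: v], then along
    v for ['D_u f]. *)
Lemma second_difference (f : V -> R) (U : set V) (a u v : V) (h : R) : 0 < h ->
  (forall s t, 0 <= s <= h -> 0 <= t <= h -> U (s *: u + (t *: v + a))) ->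
  C_on 2 U f ->
  exists s t, [/\ 0 <= s <= h, 0 <= t <= h &
    f (h *: u + (h *: v + a)) - f (h *: u + a) - f (h *: v + a) + f a =
    h ^+ 2 * 'D_v (fun b => 'D_u f b) (s *: u + (t *: v + a))].
Proof.
move=> h0 hU [df Df].
have hh : 0 <= h <= h by rewrite (ltW h0) /=.
have h00 : 0 <= (0 : R) <= h by rewrite (ltW h0) lexx.
have hU0 s : 0 <= s <= h -> U (s *: u + a).
  by move=> sh; have := hU s 0 sh h00; rewrite scale0r add0r.
have [s sh|s sh] := @MVT_derivable
  (fun s => f (s *: u + (h *: v + a)) - f (s *: u + a))
  (fun s => 'D_u f (s *: u + (h *: v + a)) - 'D_u f (s *: u + a)) 0 h (ltW h0).
  by apply: is_deriveB; apply: is_derive_line; apply: df; [exact: hU|exact: hU0].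
have [t th|t th Et Es] := @MVT_derivable
  (fun t => 'D_u f (s *: u + (t *: v + a)))
  (fun t => 'D_v (fun b => 'D_u f b) (s *: u + (t *: v + a))) 0 h (ltW h0).
  have E r : s *: u + (r *: v + a) = r *: v + (s *: u + a) by rewrite addrCA.
  rewrite E; under eq_fun do rewrite E.
  by apply: is_derive_line; have [dDu _] := Df u; apply: dDu; rewrite -E; exact: hU.
exists s, t; split=> //; move: Es Et; rewrite !scale0r !add0r subr0 => + Et.
rewrite Et => Es; rewrite expr2 mulrC mulrA -Es; ring.
Qed.

(** The second difference is symmetric in u and v. Evaluating it in both orders yields two points
    near a at which the two mixed derivatives agree, and their continuity at a does the rest. *)
Lemma derive_comm (f : V -> R) (U : set V) (a u v : V) : open U -> U a ->
  C_on 2 U f -> 'D_u (fun b => 'D_v f b) a = 'D_v (fun b => 'D_u f b) a.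
Proof.
move=> oU Ua Cf; apply/eqP; rewrite -subr_eq0 -normr_le0; apply/ler_addgt0Pr => e e0.
rewrite add0r; have e2 : 0 < e / 2 by rewrite divr_gt0.
have ct x y : {for a, continuous (fun b => 'D_x (fun b => 'D_y f b) b)}.
  by have [_ /(_ y)[_ /(_ x) H]] := Cf; apply: H.
have : \forall b \near a, [/\ U b,
    `|'D_u (fun b => 'D_v f b) a - 'D_u (fun b => 'D_v f b) b| <= e / 2 &
    `|'D_v (fun b => 'D_u f b) a - 'D_v (fun b => 'D_u f b) b| <= e / 2].
  move/cvgrPdist_le: (ct u v) => /(_ _ e2) n1.
  move/cvgrPdist_le: (ct v u) => /(_ _ e2) n2.
  have n3 : nbhs a U := open_nbhs_nbhs (conj oU Ua).
  apply: filterS (filterI n3 (filterI n1 n2)) => b [Ub [H1 H2]].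
  by split; [exact: Ub|exact: H1|exact: H2].
move=> /nbhs_ballP[d /= d0 dP].
(* For s, t in [0, h], the vector [s *: u + t *: v] has norm at most h N = d / 2 < d, so the whole
   parallelogram stays in the ball. The summand 1 keeps N positive when u = v = 0. *)
pose N := `|u| + `|v| + 1.
have N0 : 0 < N by rewrite ltr_wpDl // addr_ge0.
pose h := d / 2 / N.
have h0 : 0 < h by rewrite !divr_gt0.
have hB s t : 0 <= s <= h -> 0 <= t <= h -> ball a d (s *: u + (t *: v + a)).
  move=> /andP[s0 sh] /andP[t0 th]; rewrite -ball_normE /ball_ /=.
  have -> : a - (s *: u + (t *: v + a)) = - (s *: u + t *: v).
    by rewrite addrA opprD addrCA subrr addr0.
  rewrite normrN; apply: (@le_lt_trans _ _ (h * (`|u| + `|v|))).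
    rewrite mulrDr; apply: le_trans (ler_normD _ _) _.
    by rewrite !normrZ !ger0_norm //; apply: lerD; rewrite ler_wpM2r.
  apply: (@le_lt_trans _ _ (h * N)).
    by rewrite ler_wpM2l ?(ltW h0) // /N lerDl.
  by rewrite /h divfK ?lt0r_neq0 // ltr_pdivrMr // ltr_pMr // ltr1n.
have hU s t : 0 <= s <= h -> 0 <= t <= h -> U (s *: u + (t *: v + a)).
  by move=> sh th; have [] := dP _ (hB _ _ sh th).
have hU' s t : 0 <= s <= h -> 0 <= t <= h -> U (s *: v + (t *: u + a)).
  by move=> sh th; rewrite addrCA; exact: hU.
have [s [t [sh th E1]]] := second_difference h0 hU Cf.
have [s' [t' [sh' th' E2]]] := second_difference h0 hU' Cf.
have E3 : 'D_v (fun b => 'D_u f b) (s *: u + (t *: v + a)) =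
          'D_u (fun b => 'D_v f b) (s' *: v + (t' *: u + a)).
  have h20 : h ^+ 2 != 0 by rewrite expf_neq0 // lt0r_neq0.
  have cancel p q r r' : r = h ^+ 2 * p -> r' = h ^+ 2 * q -> r = r' -> p = q.
    by move=> -> -> /(mulfI h20).
  apply: cancel E1 E2 _; rewrite (addrCA (h *: u)).
  by congr (_ + _); exact: addrAC.
have [_ _ H1] := dP _ (hB _ _ sh th).
have [_ H2 _] := dP _ (hB _ _ th' sh').
rewrite (addrCA (t' *: u)) -E3 in H2; rewrite (splitr e).
apply: le_trans (ler_distD ('D_v (fun b => 'D_u f b) (s *: u + (t *: v + a))) _ _) _.
by apply: (lerD H2); rewrite distrC; exact: H1.
Qed.
End Schwarz.

(** * Bump functions *)

Section Bump.
Context {R : realType}.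

(** The classical flat function exp(-1/t), with a factor t^(-k) that makes the family stable under
    differentiation up to linear combinations; smoothness then follows by induction on the order,
    for all k at once. *)
Definition flat_exp (k : nat) (t : R) : R :=
  if 0 < t then t ^- k * expR (- t^-1) else 0.

(** The term of degree k + 2 of the exponential series bounds exp(1/t) from below and beats t^(-k)
    by a factor t^2. A quadratic bound is what makes the derivative at 0 vanish. *)
Lemma flat_exp_le (k : nat) (t : R) : `|flat_exp k t| <= (k.+2)`!%:R * t ^+ 2.
Proof.
rewrite /flat_exp; case: ifPn => [t0|_]; last by rewrite normr0 mulr_ge0 // sqr_ge0.
rewrite ger0_norm ?mulr_ge0 ?expR_ge0 ?invr_ge0 ?exprn_ge0 ?(ltW t0) //.
have tV0 : 0 <= t^-1 by rewrite invr_ge0 ltW.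
have E : t^-1 ^+ k.+2 / (k.+2)`!%:R <= expR t^-1.
  by apply: le_trans (expR_ge1Dxn k.+1 tV0); rewrite lerDr.
have f0 : 0 < (k.+2)`!%:R :> R by rewrite ltr0n fact_gt0.
rewrite expRN -exprVn ler_pdivrMr ?expR_gt0 //.
have -> : t^-1 ^+ k = t ^+ 2 * t^-1 ^+ k.+2.
  have t1 : t * t^-1 = 1 by rewrite mulfV // lt0r_neq0.
  transitivity (t * t^-1 * (t * t^-1) * t^-1 ^+ k); first by rewrite t1 !mul1r.
  by rewrite !exprS expr0; ring.
rewrite [leRHS]mulrAC [leRHS]mulrC ler_wpM2l ?sqr_ge0 //.
by rewrite -ler_pdivrMl // mulrC.
Qed.

Lemma is_derive_flat_exp (k : nat) (t : R) :
  is_derive t 1 (flat_exp k) (flat_exp k.+2 t - k%:R * flat_exp k.+1 t).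
Proof.
have [t0|t0|t0] := ltgtP t 0.
- have N : \near t, cst (0 : R) t = flat_exp k t.
    apply: (near_open_eq (@open_lt R 0) t0) => x; rewrite inE /= => x0.
    by rewrite /flat_exp ltNge ltW.
  apply: near_eq_is_derive N _; apply: is_derive_eq.
  by rewrite /flat_exp ltNge (ltW t0) /= mulr0 subr0.
- have N : \near t, t^-1 ^+ k * expR (- t^-1) = flat_exp k t.
    apply: (near_open_eq (@open_gt R 0) t0) => x; rewrite inE /= => x0.
    by rewrite /flat_exp x0 exprVn.
  apply: near_eq_is_derive N _.
  have tn0 : t != 0 by rewrite lt0r_neq0.
  have dV : is_derive t 1 (fun x : R => x^-1) (- t^-1 ^+ 2).
    have := is_deriveV tn0 (is_derive_id t 1).
    by rewrite /GRing.scale /= mulr1 exprVn.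
  have dX := is_deriveX k dV.
  have dE := is_derive1_comp (is_derive_expR _) (is_deriveN dV).
  have -> : (fun t : R => t^-1 ^+ k * expR (- t^-1)) =
      (fun x : R => x^-1) ^+ k * (expR \o (- (fun x : R => x^-1))).
    by apply/funext => x; rewrite /= mulrfctE /= exprfctE.
  apply: is_derive_eq.
  rewrite /flat_exp t0 /GRing.scale /= -!exprVn exprfctE.
  rewrite -[(- _) t]/(- t^-1); case: k {dX dE} => [|k]; first by rewrite !exprS expr0; ring.
  by rewrite !exprS; ring.
- have f0 j : flat_exp j 0 = 0 by rewrite /flat_exp ltxx.
  rewrite t0 !f0 mulr0 subr0; set c : R := (k.+2)`!%:R.
  have c0 : 0 < c by rewrite ltr0n fact_gt0.
  have H : (h^-1 *: (flat_exp k (h *: 1 + 0) - flat_exp k 0)) @[h --> (0 : R)^'] --> (0 : R).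
    apply/cvgrPdist_le => e e0; near=> h.
    have h0 : h != 0 by near: h; exact: nbhs_dnbhs_neq.
    have hc : `|h| <= e / c.
      by near: h; apply: dnbhs0_le; rewrite divr_gt0.
    rewrite sub0r normrN f0 subr0 addr0 /GRing.scale /= mulr1 normrM normfV.
    rewrite ler_pdivrMl ?normr_gt0 //; apply: le_trans (flat_exp_le _ _) _.
    rewrite -/c -(real_normK (num_real h)) expr2 mulrCA ler_wpM2l //.
    by rewrite mulrC -ler_pdivlMr.
  by split; [apply/cvg_ex; exists 0|exact: cvg_lim].
Unshelve. all: by end_near. Qed.

Lemma C_on_flat_exp (V : normedModType R) k j (U : set V) (f : V -> R) :
  open U -> C_on j U f -> C_on j U (flat_exp k \o f).
Proof.
have df i t : differentiable (flat_exp i) t.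
  by have [+ _] := is_derive_flat_exp i t => /derivable1_diffP.
move=> oU; elim: j k => [|j IH] k.
  move=> cf a Ua; apply: continuous_comp; first exact: cf.
  exact/differentiable_continuous/df.
move=> Cf; have [dF DF] := Cf; split=> [a Ua|v].
  by apply: differentiable_comp; [exact: dF|exact: df].
have Cf' := C_onS Cf.
have C1 := C_on_mul oU (C_on_cst j U (- k%:R : R)) (IH k.+1 Cf').
have C2 := C_on_mul oU (DF v) (C_on_add oU (IH k.+2 Cf') C1).
apply: C_on_ext oU _ C2 => a; rewrite inE => Ua.
rewrite /= (derive_comp _ (dF _ Ua) (df _ _)) mulNr.
have [_ E] := is_derive_flat_exp k (f a).
rewrite -E; move: ('D_v f a) => w.
by rewrite !deriveE // -[in RHS](mulr1 w) linearZ.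
Qed.

Lemma C_on_id (V : normedModType R) j (U : set V) : open U -> C_on j U id.
Proof.
move=> oU; case: j => [|j] /=; first by move=> a _; exact: cvg_id.
split=> // v; apply: C_on_ext oU _ (C_on_cst j U v) => a _.
by rewrite derive_id.
Qed.

(** The norm on rows is the maximum of the coordinates, so a product of one-variable bumps suffices:
    outside the cube some coordinate is off by at least r and kills its factor. *)
Lemma bump_exists m (a : 'rV[R]_m) (r : R) : 0 < r ->
  exists b : 'rV[R]_m -> R, [/\ smooth_on setT b, b a = 1 &
    forall c, r <= `|c - a| -> b c = 0].
Proof.
move=> r0; pose F j (c : 'rV[R]_m) := flat_exp 0 (r ^+ 2 - (c 0 j - a 0 j) ^+ 2).
pose P c := \prod_j F j c.
have Pa : 0 < P a.
  apply: prodr_gt0 => j _; rewrite /F subrr expr0n /= subr0 /flat_exp.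
  by rewrite exprn_gt0 // mulr_gt0 ?expR_gt0 // expr0 invr1.
exists (fun c => (P a)^-1 * P c); split.
- move=> k; have oT : open [set: 'rV[R]_m] by exact: openT.
  apply: (C_on_mul oT (C_on_cst k setT (P a)^-1)).
  have CF j : C_on k setT (F j).
    apply: (@C_on_flat_exp _ _ _ _ (fun c : 'rV[R]_m => r ^+ 2 - (c 0 j - a 0 j) ^+ 2)) => //.
    have C1 : C_on k setT (fun c : 'rV[R]_m => c 0 j - a 0 j).
      by apply: (C_on_add oT _ (C_on_cst k setT _)); apply: C_on_coord => //; exact: C_on_id.
    have C2 := C_on_mul oT (C_on_cst k setT (-1 : R)) (C_on_mul oT C1 C1).
    apply: C_on_ext oT _ (C_on_add oT (C_on_cst k setT (r ^+ 2)) C2) => c _ /=.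
    by rewrite mulN1r expr2.
  rewrite /P; elim: (index_enum _) => [|j s IH].
    by apply: C_on_ext oT _ (C_on_cst k setT (1 : R)) => c _; rewrite big_nil.
  by apply: C_on_ext oT _ (C_on_mul oT (CF j) IH) => c _; rewrite big_cons.
- by rewrite mulVf // lt0r_neq0.
- move=> c rc; have [j rj] : exists j, r <= `|c 0 j - a 0 j|.
    apply/not_existsP => H; move: rc; apply/negP; rewrite -ltNge.
    rewrite [X in X < _]/Num.Def.normr /= mx_normrE.
    apply/bigmax_ltP; split=> // -[i j] _ /=; rewrite ltNge; apply/negP.
    by have := H j; rewrite ord1 !mxE.
  suff Fj : F j c == 0.
    suff -> : P c = 0 by rewrite mulr0.
    by apply/eqP/prodf_eq0; exists j.
  rewrite /F /flat_exp ltNge; case: ifP => // /negP[].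
  rewrite subr_le0 -(real_normK (num_real (c 0 j - _))).
  by rewrite lerXn2r ?nnegrE ?(ltW r0).
Qed.
End Bump.

(** * Vector fields in charts *)

Section Charts.
Context {R : realType} {m : nat} {M : manifold R m}.
Implicit Types (i j k : chart M) (x y : M) (O : set M) (X Y : vfield M).

Lemma img_inv i a : img i a -> dom i (chart_inv i a) /\ coord i (chart_inv i a) = a.
Proof. by move=> [x xi <-]; rewrite coordK. Qed.

Lemma coord_img i x : dom i x -> img i (coord i x).
Proof. by move=> xi; exists x. Qed.

Lemma open_chart i O : open O -> open (coord i @` (dom i `&` O)).
Proof.
move=> oO; rewrite openE => _ [x [xi xO] <-]; rewrite /interior.
have Ia := coord_img xi.
have n1 := open_nbhs_nbhs (conj (@img_open _ _ M i) Ia).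
have n2 : nbhs (coord i x) (chart_inv i @^-1` O).
  by apply: (inv_cont Ia); rewrite coordK //; exact: open_nbhs_nbhs.
apply: filterS2 n1 n2 => b /img_inv[bi bE] bO.
by exists (chart_inv i b).
Qed.

Lemma in_open_chart i O a :
  (coord i @` (dom i `&` O)) a <-> img i a /\ O (chart_inv i a).
Proof.
split=> [[x [xi xO] <-]|[ai aO]]; first by rewrite coordK //; split=> //; exact: coord_img.
by have [bi bE] := img_inv ai; exists (chart_inv i a).
Qed.

Lemma transition_differentiable i j x : dom i x -> dom j x ->
  differentiable (coord j \o chart_inv i) (coord i x).
Proof.
by move=> xi xj; have [+ _] := transition_smooth i j 1; apply; exists x.
Qed.

Lemma transition_coord i j x : dom i x -> (coord j \o chart_inv i) (coord i x) = coord j x.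
Proof. by move=> xi; rewrite /= coordK. Qed.

Lemma near_transition S (f : M -> S) i j x : dom i x -> dom j x ->
  \forall a \near coord i x,
    (f \o chart_inv i) a = ((f \o chart_inv j) \o (coord j \o chart_inv i)) a.
Proof.
move=> xi xj.
have oD := open_chart (i := i) (@dom_open _ _ M j).
apply: (near_open_eq oD); first by exists x.
by move=> a; rewrite inE => -[y [yi yj] <-] /=; rewrite !coordK.
Qed.

Lemma near_coordK i x : dom i x ->
  \forall a \near coord i x, (coord i \o chart_inv i) a = a.
Proof.
move=> xi; apply: (near_open_eq (@img_open _ _ M i) (coord_img xi)) => a.
by rewrite inE => /img_inv[].
Qed.

Lemma derive_coordK i x v : dom i x -> 'D_v (coord i \o chart_inv i) (coord i x) = v.
Proof. by move=> xi; rewrite (near_eq_derive _ (near_coordK xi)) derive_id. Qed.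

Lemma comp_in_chart_at X x : comp_in (chart_at x) X x = X x.
Proof. exact/derive_coordK/chart_atP. Qed.

(** Transition maps compose near the point, so this is the chain rule; changes of components between
    charts rest on it. *)
Lemma derive_transition i j k x v : dom i x -> dom j x -> dom k x ->
  'D_('D_v (coord j \o chart_inv i) (coord i x)) (coord k \o chart_inv j) (coord j x)
  = 'D_v (coord k \o chart_inv i) (coord i x).
Proof.
move=> xi xj xk; rewrite (near_eq_derive _ (near_transition (coord k) xi xj)).
rewrite [RHS]derive_comp ?transition_coord //; first exact: transition_differentiable.
exact: transition_differentiable.
Qed.

Lemma comp_in_change i k X x : dom i x -> dom k x ->
  comp_in k X x = 'D_(comp_in i X x) (coord k \o chart_inv i) (coord i x).
Proof. by move=> xi xk; rewrite derive_transition //; exact: chart_atP. Qed.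

Lemma smooth_fun_differentiable (f : M -> R) i x : smooth_fun f -> dom i x ->
  differentiable (f \o chart_inv i) (coord i x).
Proof. by move=> sf xi; have [+ _] := sf i 1; apply; exact: coord_img. Qed.

Lemma dirder_chart i X (f : M -> R) x : dom i x -> smooth_fun f ->
  dirder X f x = 'D_(comp_in i X x) (f \o chart_inv i) (coord i x).
Proof.
move=> xi sf; have xc := chart_atP x.
rewrite /dirder (near_eq_derive _ (near_transition f xc xi)).
rewrite derive_comp ?transition_coord //; first exact: transition_differentiable.
exact: smooth_fun_differentiable.
Qed.

Lemma dirder_smooth X (f : M -> R) :
  smooth_vfield X -> smooth_fun f -> smooth_fun (dirder X f).
Proof.
move=> sX sf i k; have oI : open (img i) := @img_open _ _ M i.
have H (j : 'I_m) : C_on k (img i) (fun a => (comp_in i X \o chart_inv i) a 0 j *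
    'D_(delta_mx 0 j) (f \o chart_inv i) a).
  apply: C_on_mul => //; first exact/C_on_coord/sX.
  by have [_] := sf i k.+1; apply.
apply: C_on_ext oI _ (C_on_sum (index_enum 'I_m) oI H) => a; rewrite inE => Ia.
have [ai aE] := img_inv Ia.
rewrite /= (dirder_chart _ ai) // aE derive_sum_coord //.
by rewrite -[X in differentiable _ X]aE; exact: smooth_fun_differentiable.
Qed.

Lemma smooth_funD (f h : M -> R) :
  smooth_fun f -> smooth_fun h -> smooth_fun (f \+ h).
Proof. by move=> sf sh i k; apply: (C_on_add (@img_open _ _ M i)); [exact: sf|exact: sh]. Qed.

Lemma smooth_funM (f h : M -> R) :
  smooth_fun f -> smooth_fun h -> smooth_fun (f \* h).
Proof. by move=> sf sh i k; apply: (C_on_mul (@img_open _ _ M i)); [exact: sf|exact: sh]. Qed.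

Lemma smooth_fun_cst (c : R) : smooth_fun (cst c : M -> R).
Proof. by move=> i k; exact: C_on_cst. Qed.

Lemma comp_inD i X Y x : dom i x ->
  comp_in i (X \+ Y) x = comp_in i X x + comp_in i Y x.
Proof.
move=> xi; have dt := transition_differentiable (chart_atP x) xi.
exact: derive_addv.
Qed.

Lemma comp_inZ i (f : M -> R) X x : dom i x ->
  comp_in i (scalef f X) x = f x *: comp_in i X x.
Proof.
move=> xi; have dt := transition_differentiable (chart_atP x) xi.
exact: derive_scalev.
Qed.

Lemma smooth_vfieldD X Y :
  smooth_vfield X -> smooth_vfield Y -> smooth_vfield (X \+ Y).
Proof.
move=> sX sY i k; have oI : open (img i) := @img_open _ _ M i.
apply: C_on_ext oI _ (C_on_add oI (sX i k) (sY i k)) => a; rewrite inE => Ia.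
by have [ai aE] := img_inv Ia; rewrite /= comp_inD.
Qed.

Lemma smooth_vfieldZ (f : M -> R) X :
  smooth_fun f -> smooth_vfield X -> smooth_vfield (scalef f X).
Proof.
move=> sf sX i k; have oI : open (img i) := @img_open _ _ M i.
apply: C_on_ext oI _ (C_on_scale oI (sf i k) (sX i k)) => a; rewrite inE => Ia.
by have [ai aE] := img_inv Ia; rewrite /= comp_inZ.
Qed.

Lemma dirderDl X Y (f : M -> R) : smooth_fun f ->
  dirder (X \+ Y) f = dirder X f \+ dirder Y f.
Proof.
move=> sf; apply/funext => x.
have df := smooth_fun_differentiable sf (chart_atP x).
exact: derive_addv.
Qed.

Lemma dirderD X (f h : M -> R) : smooth_fun f -> smooth_fun h ->
  dirder X (f \+ h) = dirder X f \+ dirder X h.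
Proof.
move=> sf sh; apply/funext => x.
have df := smooth_fun_differentiable sf (chart_atP x).
have dh := smooth_fun_differentiable sh (chart_atP x).
by rewrite /dirder /= -deriveD //; exact: diff_derivable.
Qed.

Lemma dirderM X (f h : M -> R) : smooth_fun f -> smooth_fun h ->
  dirder X (f \* h) = (dirder X f \* h) \+ (f \* dirder X h).
Proof.
move=> sf sh; apply/funext => x; have xc := chart_atP x.
have df := smooth_fun_differentiable sf xc.
have dh := smooth_fun_differentiable sh xc.
rewrite /dirder /=; transitivity ('D_(X x) ((f \o chart_inv (chart_at x)) *
   (h \o chart_inv (chart_at x))) (coord (chart_at x) x)); first by [].
rewrite deriveM; [|exact: diff_derivable..].
rewrite /= (coordK xc) /GRing.scale /=.
have alg (p q r s : R) : p * q + r * s = s * r + p * q by ring.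
exact: alg.
Qed.

Lemma dirder_cst X (c : R) : dirder X (cst c) = cst 0.
Proof. by apply/funext => x; rewrite /dirder (_ : _ \o _ = cst c) // derive_cst. Qed.

(** In the chart of x held fixed, X (Y f) is a derivative of f along ['D_(X x)] of the components of
    Y, plus a second derivative of f. The latter is symmetric by Schwarz and leaves the commutator;
    the former gives the bracket. *)
Lemma bracket_dirder X Y (f : M -> R) :
  smooth_vfield X -> smooth_vfield Y -> smooth_fun f ->
  dirder (bracket X Y) f = dirder X (dirder Y f) \- dirder Y (dirder X f).
Proof.
move=> sX sY sf; apply/funext => x /=; set i := chart_at x.
have xi : dom i x by exact: chart_atP.
have oI : open (img i) := @img_open _ _ M i; have Ix := coord_img xi.
pose F := f \o chart_inv i; pose a := coord i x.
have CF : C_on 2 (img i) F by exact: sf.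
have second Z W : smooth_vfield W ->
    dirder Z (dirder W f) x =
    'D_('D_(Z x) (comp_in i W \o chart_inv i) a) F a + 'D_(Z x) (fun b => 'D_(W x) F b) a.
  move=> sW; pose w := comp_in i W \o chart_inv i.
  have dw : differentiable w a by have [+ _] := sW i 1; apply.
  have dF : differentiable F a by have [+ _] := CF; apply.
  have dDF v : differentiable (fun b => 'D_v F b) a.
    by have [_ /(_ v)[+ _]] := CF; apply.
  have wa : w a = W x by rewrite /w /= /a coordK // comp_in_chart_at.
  have dwj (j : 'I_m) : differentiable (fun b => w b 0 j) a.
    exact: (differentiable_comp dw (differentiable_coord _ _ _)).
  have E : \forall b \near a, (dirder W f \o chart_inv i) b =
      (\sum_(j < m) (fun b => w b 0 j) * (fun b => 'D_(delta_mx 0 j) F b)) b.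
    apply: (near_open_eq oI Ix) => b; rewrite inE => Ib.
    have [bi bE] := img_inv Ib; rewrite /= (dirder_chart _ bi) // bE.
    rewrite derive_sum_coord ?fct_sumE //.
    by have [+ _] := CF; apply.
  rewrite {1}/dirder -/i -/a (near_eq_derive _ E).
  rewrite derive_sum; last first.
    by move=> j; apply: derivableM; apply: diff_derivable.
  rewrite (derive_sum_coord _ dF).
  have -> : 'D_(Z x) (fun b => 'D_(W x) F b) a =
      \sum_(j < m) W x 0 j * 'D_(Z x) (fun b => 'D_(delta_mx 0 j) F b) a.
    have E' : \forall b \near a, 'D_(W x) F b =
        (\sum_(j < m) (W x 0 j \*: (fun b => 'D_(delta_mx 0 j) F b))) b.
      apply: (near_open_eq oI Ix) => b; rewrite inE => Ib.
      rewrite derive_sum_coord ?fct_sumE //.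
      by have [+ _] := CF; apply.
    rewrite (near_eq_derive _ E') derive_sum; last first.
      by move=> j; apply: derivableZ; apply: diff_derivable.
    by apply: eq_bigr => j _; rewrite deriveZ //; exact: diff_derivable.
  rewrite -big_split /=; apply: eq_bigr => j _.
  rewrite deriveM; [|exact: diff_derivable..].
  rewrite wa addrC; congr (_ + _); rewrite [LHS]mulrC; congr (_ * _).
  rewrite -/w [in RHS](@derive_mx _ _ 1 m w) ?mxE //.
  exact: diff_derivable.
have dF : differentiable F a by have [+ _] := CF; apply.
have DB u v : 'D_(u - v) F a = 'D_u F a - 'D_v F a by rewrite !deriveE // linearB.
have DC := derive_comm (X x) (Y x) oI Ix CF.
rewrite (second X Y sY) (second Y X sX).
rewrite /dirder /bracket -/i -/a -/F.
rewrite DB.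
have alg (p q r s : R) : q = s -> p - r = p + q - (r + s) by move=> ->; ring.
exact: alg DC.
Qed.

End Charts.

Lemma ball_rV_le (R : realType) m (u : 'rV[R]_m) (r : R) : 0 <= r ->
  `|u| <= r <-> (forall j, `|u 0 j| <= r).
Proof.
move=> r0; rewrite [X in X <= _]/Num.Def.normr /= mx_normrE; split.
  by move=> /bigmax_leP[_ H] j; exact: (H (0, j)).
by move=> H; apply/bigmax_leP; split=> // -[i j] _ /=; rewrite ord1.
Qed.

(** * Cutoffs: from local data to global functions and fields *)

Section Cutoff.
Context {R : realType} {m : nat} {M : manifold R m}.
Implicit Types (i k : chart M) (x y : M) (O : set M) (X Y : vfield M).

(* Together with dom i, the open set O covers M, and b vanishes on O; so b times
   a smooth function or field on the chart i extends by 0 to all of M. *)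
Definition cutoff i (b : 'rV[R]_m -> R) O : Prop :=
  [/\ smooth_on setT b, open O, (forall y, dom i y \/ O y) &
      forall y, dom i y -> O y -> b (coord i y) = 0].

(** The bump vanishes outside a closed cube K contained in the image of the chart. K is a product of
    segments, hence compact; its image in M is compact, hence closed as M is Hausdorff, and O is the
    complement of that image. *)
Lemma cutoff_exists i x : dom i x ->
  exists b O, cutoff i b O /\ b (coord i x) = 1.
Proof.
move=> xi; set a := coord i x.
have := open_nbhs_nbhs (conj (@img_open _ _ M i) (coord_img xi)).
rewrite -/a => /nbhs_ballP[e /= e0 eI].
have r0 : 0 < e / 2 by rewrite divr_gt0.
set r := e / 2 in r0 *.
have [b [sb ba b0]] := bump_exists a r0.
pose K := [set c : 'rV[R]_m | forall j, (`[a 0 j - r, a 0 j + r]%classic : set R) (c ord0 j)].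
have KP c : K c <-> `|c - a| <= r.
  rewrite (ball_rV_le _ (ltW r0)); split=> H j; move: (H j).
    by rewrite /= in_itv /= !mxE ler_distl.
  by rewrite !mxE ler_distl /= in_itv.
have KI : K `<=` img i.
  move=> c /KP cr; apply: eI; rewrite -ball_normE /ball_ /= distrC.
  by apply: le_lt_trans cr _; rewrite /r ltr_pdivrMr // ltr_pMr // ltr1n.
have cK : compact K.
  apply: (@rV_compact _ _ (fun j => `[a 0 j - r, a 0 j + r]%classic : set R)) => j.
  exact: segment_compact.
have cM : compact (chart_inv i @` K).
  apply: continuous_compact cK; apply/continuous_in_subspaceT => c.
  by rewrite inE => /KI; exact: inv_cont.
exists b, (~` (chart_inv i @` K)); split=> //; split=> //.
- by apply: closed_openC; apply: compact_closed cM; exact: manifold_hausdorff.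
- move=> y; have [[c Kc <-]|nK] := pselect ((chart_inv i @` K) y); last by right.
  by left; have [] := img_inv (KI _ Kc).
- move=> y yi nK; apply: b0; rewrite leNgt; apply/negP => /ltW yr; apply: nK.
  by exists (coord i y); [exact/KP|exact: coordK].
Qed.

Definition cut_fun i (b u : 'rV[R]_m -> R) : M -> R := fun y =>
  if `[< dom i y >] then b (coord i y) * u (coord i y) else 0.

(** The constant field v of the chart i, damped by b and rewritten in the frame of [chart_at y],
    where fields are represented. *)
Definition cut_field i (b : 'rV[R]_m -> R) (v : 'rV[R]_m) : vfield M := fun y =>
  if `[< dom i y >] then
    b (coord i y) *: 'D_v (coord (chart_at y) \o chart_inv i) (coord i y)
  else 0.

Lemma img_cover i k O : (forall y, dom i y \/ O y) ->
  img k `<=` coord k @` (dom k `&` dom i) `|` coord k @` (dom k `&` O).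
Proof.
move=> cov a Ia; case: (cov (chart_inv k a)) => ya; [left|right];
  exact/in_open_chart.
Qed.

(** Seen in a chart k, the function is a composite with a transition map over [dom i] and is 0 over
    O; these two open regions cover the image of k. *)
Lemma cut_fun_smooth i b O (u : 'rV[R]_m -> R) : cutoff i b O ->
  smooth_on (img i) u -> smooth_fun (cut_fun i b u).
Proof.
move=> [sb oO cov b0] su k n.
apply: (C_on_sub (img_cover (k := k) cov)); apply: C_on_setU.
  have oD := open_chart (i := k) (@dom_open _ _ M i).
  have Cbu : C_on n (img i) (b \* u).
    by apply: (C_on_mul (@img_open _ _ M i)) (su n); apply: C_on_sub (sb n).
  have tI a : (coord k @` (dom k `&` dom i)) a -> img i ((coord i \o chart_inv k) a).
    by move=> /in_open_chart[_ ?]; exact: coord_img.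
  apply: C_on_ext oD _ (C_on_comp_real oD tI (transition_smooth k i n) Cbu) => a.
  by rewrite inE => /in_open_chart[_ ya]; rewrite /= /cut_fun asboolT.
have oD := open_chart (i := k) oO.
apply: C_on_ext oD _ (C_on_cst n _ (0 : R)) => a.
rewrite inE => /in_open_chart[_ ya]; rewrite /= /cut_fun.
by case: asboolP => // yi; rewrite b0 // mul0r.
Qed.

Lemma cut_fieldE i b v k y : dom i y -> dom k y ->
  comp_in k (cut_field i b v) y =
  b (coord i y) *: 'D_v (coord k \o chart_inv i) (coord i y).
Proof.
move=> yi yk; have yc := chart_atP y.
have dt := transition_differentiable yc yk.
rewrite /comp_in /cut_field asboolT //.
by rewrite (derive_scalev _ _ dt) (derive_transition _ yi yc yk).
Qed.

Lemma cut_field_smooth i b O v : cutoff i b O -> smooth_vfield (cut_field i b v).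
Proof.
move=> [sb oO cov b0] k n.
apply: (C_on_sub (img_cover (k := k) cov)); apply: C_on_setU.
  have oD := open_chart (i := k) (@dom_open _ _ M i).
  have oD' := open_chart (i := i) (@dom_open _ _ M k).
  have Cb : C_on n (coord i @` (dom i `&` dom k)) b by apply: C_on_sub (sb n).
  have CD : C_on n (coord i @` (dom i `&` dom k)) (fun a => 'D_v (coord k \o chart_inv i) a).
    by have [_] := transition_smooth i k n.+1; apply.
  have tI a : (coord k @` (dom k `&` dom i)) a ->
      (coord i @` (dom i `&` dom k)) ((coord i \o chart_inv k) a).
    by move=> [y [yk yi] <-]; exists y => //; rewrite /= coordK.
  have := C_on_comp oD oD' tI (transition_smooth k i n) (C_on_scale oD' Cb CD).
  apply: C_on_ext oD _ => a.
  by rewrite inE => /in_open_chart[+ ya] => /img_inv[yk _]; rewrite /= cut_fieldE.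
have oD := open_chart (i := k) oO.
apply: C_on_ext oD _ (C_on_cst n _ (0 : 'rV[R]_m)) => a.
rewrite inE => /in_open_chart[+ ya] => /img_inv[yk _] /=.
have [yi|yi] := pselect (dom i (chart_inv k a)).
  by rewrite cut_fieldE // b0 // scale0r.
by rewrite /comp_in /cut_field asboolF // derive0.
Qed.

Lemma vfield_at (x : M) (v : 'rV[R]_m) : exists X, smooth_vfield X /\ X x = v.
Proof.
have xi := chart_atP x; have [b [N [cb b1]]] := cutoff_exists xi.
exists (cut_field (chart_at x) b v); split; first exact: cut_field_smooth cb.
by rewrite -comp_in_chart_at cut_fieldE // b1 scale1r derive_coordK.
Qed.

Lemma coord_fun_at (x : M) (j : 'I_m) : exists f : M -> R, smooth_fun f /\
  forall X, dirder X f x = X x 0 j.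
Proof.
set i := chart_at x; have xi : dom i x by exact: chart_atP.
have [b [N [cb b1]]] := cutoff_exists xi; have [sb _ _ _] := cb.
pose u (c : 'rV[R]_m) := c 0 j - coord i x 0 j.
have du c : differentiable u c.
  by apply: differentiableB => //; exact: differentiable_coord.
have db c : differentiable b c by have [+ _] := sb 1; apply.
have su : smooth_on (img i) u.
  move=> n; have oI : open (img i) := @img_open _ _ M i.
  apply: (C_on_add oI) (C_on_cst _ _ _).
  by apply: C_on_coord => //; exact: C_on_id.
exists (cut_fun i b u); split; first exact: cut_fun_smooth cb su.
move=> X; rewrite /dirder -/i.
have E : \forall c \near coord i x, (cut_fun i b u \o chart_inv i) c = (b * u) c.
  apply: (near_open_eq (@img_open _ _ M i) (coord_img xi)) => c.
  by rewrite inE => /img_inv[ci cE]; rewrite /= /cut_fun asboolT // cE.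
rewrite (near_eq_derive _ E) deriveM; [|exact: diff_derivable..].
(* The factor u vanishes at x, so the Leibniz rule keeps only b = 1 times the derivative of u. *)
rewrite {2}/u subrr scale0r addr0 b1 scale1r.
rewrite deriveB; [|exact/diff_derivable/differentiable_coord|exact: derivable_cst].
rewrite derive_cst subr0 -[in RHS](derive_id (coord i x) (X x)).
by rewrite (@derive_mx _ _ 1 m id) ?mxE //; exact: derivable_id.
Qed.

Lemma smooth_vfield0 : smooth_vfield (fun _ : M => 0 : 'rV[R]_m).
Proof.
move=> i n; apply: C_on_ext (C_on_cst n _ (0 : 'rV[R]_m)); first exact: img_open.
by move=> a _; rewrite /= /comp_in derive0.
Qed.

Lemma smooth_vfield_sum I (s : seq I) (F : I -> vfield M) :
  (forall j, smooth_vfield (F j)) -> smooth_vfield (fun y => \sum_(j <- s) F j y).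
Proof.
move=> sF; elim: s => [|j s IH].
  rewrite (_ : (fun _ => _) = (fun _ => 0)); first exact: smooth_vfield0.
  by apply/funext => y; rewrite big_nil.
rewrite (_ : (fun _ => _) = F j \+ (fun y => \sum_(j <- s) F j y)).
  exact: (smooth_vfieldD (sF j) IH).
by apply/funext => y; rewrite big_cons.
Qed.

(* A C^oo(M)-linear map on vector fields acts pointwise: multiplying X by the
   square of a cutoff function writes it as a combination of global fields. *)
Lemma tensorial_at (W : lmodType R) (x : M) (T : vfield M -> W) :
  (forall X Y, smooth_vfield X -> smooth_vfield Y -> T (X \+ Y) = T X + T Y) ->
  (forall f X, smooth_fun f -> smooth_vfield X -> T (scalef f X) = f x *: T X) ->
  exists t : 'I_m -> W, forall X, smooth_vfield X -> T X = \sum_j X x 0 j *: t j.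
Proof.
move=> TD TZ; set i := chart_at x; have xi : dom i x by exact: chart_atP.
have [b [N [cb b1]]] := cutoff_exists xi.
pose E j := cut_field i b (delta_mx 0 j).
have sE j : smooth_vfield (E j) by exact: cut_field_smooth cb.
exists (fun j => T (E j)) => X sX.
pose chi := cut_fun i b (cst 1).
have schi : smooth_fun chi by apply: cut_fun_smooth cb _ => n; exact: C_on_cst.
pose w j (c : 'rV[R]_m) := (comp_in i X \o chart_inv i) c 0 j.
pose f j := cut_fun i b (w j).
have sf j : smooth_fun (f j).
  apply: cut_fun_smooth cb _ => n; apply: C_on_coord; first exact: img_open.
  exact: sX.
have chix : chi x = 1 by rewrite /chi /cut_fun asboolT // b1 mulr1.
have fx j : f j x = X x 0 j.
  by rewrite /f /cut_fun asboolT // b1 mul1r /w /= coordK // comp_in_chart_at.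
have EX : scalef chi (scalef chi X) = fun y => \sum_j scalef (f j) (E j) y.
  apply/funext => y; rewrite /scalef /chi /f /E /cut_fun /cut_field.
  case: asboolP => yi; last by rewrite scale0r big1 // => j _; rewrite scale0r.
  rewrite mulr1 -[X y]comp_in_chart_at (comp_in_change X yi (chart_atP y)).
  rewrite derive_sum_coord; last first.
    exact: transition_differentiable yi (chart_atP y).
  rewrite !scaler_sumr; apply: eq_bigr => j _.
  by rewrite /w /= coordK // !scalerA; congr (_ *: _); ring.
have T0 : T (fun _ => 0) = 0.
  rewrite (_ : (fun _ => 0) = scalef (cst 0) X); last first.
    by apply/funext => y; rewrite /scalef scale0r.
  by rewrite TZ ?scale0r //; exact: smooth_fun_cst.
have Tsum (s : seq 'I_m) : T (fun y => \sum_(j <- s) scalef (f j) (E j) y) =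
    \sum_(j <- s) X x 0 j *: T (E j).
  elim: s => [|j s IH].
    by rewrite big_nil -T0; congr T; apply/funext => y; rewrite big_nil.
  have sfE l : smooth_vfield (scalef (f l) (E l)) := smooth_vfieldZ (sf l) (sE l).
  rewrite big_cons -IH -fx -(TZ _ _ (sf j) (sE j)).
  rewrite -(TD _ _ (sfE j) (smooth_vfield_sum s sfE)).
  by congr T; apply/funext => y; rewrite big_cons.
have := Tsum (index_enum _); rewrite -EX (TZ _ _ schi (smooth_vfieldZ schi sX)).
by rewrite (TZ _ _ schi sX) chix !scale1r.
Qed.

End Cutoff.

(** * Levi-Civita connections *)

Section VectorFields.
Context {R : realType} {m : nat} {M : manifold R m}.
Implicit Types (X Y Z W U V : vfield M) (f h : M -> R).

Lemma smooth_vfieldN X : smooth_vfield X -> smooth_vfield (\- X).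
Proof.
move=> sX; rewrite (_ : \- X = scalef (cst (-1)) X).
  by apply: smooth_vfieldZ => //; exact: smooth_fun_cst.
by apply/funext => x; rewrite /scalef /= scaleN1r.
Qed.

Lemma smooth_vfieldB X Y :
  smooth_vfield X -> smooth_vfield Y -> smooth_vfield (X \- Y).
Proof.
by move=> sX sY; apply: (smooth_vfieldD sX); exact: smooth_vfieldN.
Qed.

Lemma smooth_funN f : smooth_fun f -> smooth_fun (\- f).
Proof.
move=> sf; rewrite (_ : \- f = cst (-1) \* f).
  by apply: smooth_funM => //; exact: smooth_fun_cst.
by apply/funext => x; rewrite /= mulN1r.
Qed.

Lemma smooth_funB f h : smooth_fun f -> smooth_fun h -> smooth_fun (f \- h).
Proof. by move=> sf sh; apply: (smooth_funD sf); exact: smooth_funN. Qed.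

Lemma dirderN X f : smooth_fun f -> dirder X (\- f) = \- dirder X f.
Proof.
move=> sf; rewrite (_ : \- f = cst (-1) \* f); last first.
  by apply/funext => x; rewrite /= mulN1r.
rewrite dirderM //; last exact: smooth_fun_cst.
by rewrite dirder_cst; apply/funext => x /=; rewrite mul0r add0r mulN1r.
Qed.

Lemma dirderB X f h : smooth_fun f -> smooth_fun h ->
  dirder X (f \- h) = dirder X f \- dirder X h.
Proof.
by move=> sf sh; rewrite (dirderD X sf (smooth_funN sh)) dirderN.
Qed.

Lemma bracketC X Y : bracket X Y = \- bracket Y X.
Proof. by apply/funext => x; exact/esym/opprB. Qed.

Lemma bracket0l Y : bracket (fun _ => 0) Y = fun _ => 0.
Proof.
apply/funext => x; rewrite /bracket derive0 sub0r.
rewrite (_ : _ \o _ = cst 0) ?derive_cst ?oppr0 //.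
by apply/funext => y; rewrite /= /comp_in derive0.
Qed.

Lemma dirder0l f : dirder (fun _ => 0) f = fun _ => 0.
Proof. by apply/funext => x; rewrite /dirder derive0. Qed.

(** Coordinate functions, cut off to all of M, separate tangent vectors; identities between fields
    can thus be checked as identities between derivations. *)
Lemma vector_dirderP x (u v : vfield M) :
  (forall f, smooth_fun f -> dirder u f x = dirder v f x) -> u x = v x.
Proof.
move=> H; apply/rowP => j; have [f [sf fE]] := coord_fun_at x j.
by rewrite -!fE; exact: H.
Qed.

End VectorFields.

(* [ring] and [lra] compare atoms up to conversion, which does not terminate in
   practice on iterated derivatives. *)
Ltac generalize_dirder := repeat match goal with
  | |- context [dirder ?X ?f ?x] => generalize (dirder X f x); intro
  end.
Ltac generalize_bracket := repeat match goal with
  | |- context [bracket ?X ?Y] => generalize (bracket X Y); intro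
  end.
Ltac generalize_vfield nabla := repeat match goal with
  | |- context [nabla ?X ?Y ?x] => generalize (nabla X Y x); intro
  end.
Ltac generalize_endo := repeat match goal with
  | |- context [endo_at ?phi ?x ?u] => generalize (endo_at phi x u); intro
  end.
Ltac generalize_met := repeat match goal with
  | |- context [met_at ?g ?x ?u ?v] => generalize (met_at g x u v); intro
  end.

Section MetricAlgebra.
Context {R : realType} {m : nat} {M : manifold R m} (g : M -> 'M[R]_m).
Implicit Types (u v w : 'rV[R]_m) (x : M).

Lemma met_atDl x u v w : met_at g x (u + v) w = met_at g x u w + met_at g x v w.
Proof. by rewrite /met_at !mulmxDl mxE. Qed.

Lemma met_atNl x u w : met_at g x (- u) w = - met_at g x u w.
Proof. by rewrite /met_at !mulNmx mxE. Qed.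

Lemma met_atZl x c u w : met_at g x (c *: u) w = c * met_at g x u w.
Proof. by rewrite /met_at -!scalemxAl mxE. Qed.

Lemma met_atDr x u v w : met_at g x u (v + w) = met_at g x u v + met_at g x u w.
Proof. by rewrite /met_at linearD /= mulmxDr mxE. Qed.

Lemma met_atNr x u w : met_at g x u (- w) = - met_at g x u w.
Proof. by rewrite /met_at linearN /= mulmxN mxE. Qed.

Lemma met_atZr x c u w : met_at g x u (c *: w) = c * met_at g x u w.
Proof. by rewrite /met_at linearZ /= -scalemxAr mxE. Qed.

Lemma met_at0l x w : met_at g x 0 w = 0.
Proof. by rewrite /met_at !mul0mx mxE. Qed.

Lemma met_at0r x u : met_at g x u 0 = 0.
Proof. by rewrite /met_at trmx0 mulmx0 mxE. Qed.

Definition met_atE := (met_atDl, met_atNl, met_atZl, met_atDr, met_atNr, met_atZr).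

End MetricAlgebra.

Section LeviCivita.
Context {R : realType} {m : nat} {M : manifold R m}.
Context {g : M -> 'M[R]_m} {nabla : vfield M -> vfield M -> vfield M}.
Context (gP : riemannian_metric g) (LC : levi_civita g nabla).
Implicit Types (X Y Z W U V : vfield M) (f h : M -> R) (x : M).

Lemma smooth_met X Y : smooth_vfield X -> smooth_vfield Y -> smooth_fun (met g X Y).
Proof. by case: gP => gS _ _ sX sY; exact: (gS X Y sX sY). Qed.

Lemma met_atC x u v : met_at g x u v = met_at g x v u.
Proof. by case: gP => _ gC _; exact: (gC x u v). Qed.

Lemma met_at_inj x u v :
  (forall Z, smooth_vfield Z -> met_at g x u (Z x) = met_at g x v (Z x)) -> u = v.
Proof.
move=> H; apply/eqP; rewrite -subr_eq0; apply/negP => /negP uv.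
have [Z [sZ Zx]] := vfield_at x (u - v).
have [_ _ /(_ x _ uv)] := gP.
by rewrite -{2}Zx met_atDl met_atNl H // subrr ltxx.
Qed.

Lemma nablaZc_r c X Y : smooth_vfield X -> smooth_vfield Y ->
  nabla X (scalef (cst c) Y) = scalef (cst c) (nabla X Y).
Proof.
move=> sX sY; rewrite (nabla_leibniz LC) //; last exact: smooth_fun_cst.
by rewrite dirder_cst; apply/funext => x; rewrite /scalef /= scale0r add0r.
Qed.

Lemma scalefN1 X : \- X = scalef (cst (-1)) X.
Proof. by apply/funext => x; rewrite /scalef /= scaleN1r. Qed.

Lemma smooth_vfieldZc c X : smooth_vfield X -> smooth_vfield (scalef (cst c) X).
Proof. by apply: smooth_vfieldZ; exact: smooth_fun_cst. Qed.

Lemma nablaNr X Y : smooth_vfield X -> smooth_vfield Y ->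
  nabla X (\- Y) = \- nabla X Y.
Proof. by move=> sX sY; rewrite !scalefN1 nablaZc_r. Qed.

Lemma nablaNl X Y : smooth_vfield X -> smooth_vfield Y ->
  nabla (\- X) Y = \- nabla X Y.
Proof.
by move=> sX sY; rewrite !scalefN1 (nabla_scalel LC) //; exact: smooth_fun_cst.
Qed.

Lemma nablaBr X Y Z : smooth_vfield X -> smooth_vfield Y -> smooth_vfield Z ->
  nabla X (Y \- Z) = nabla X Y \- nabla X Z.
Proof.
move=> sX sY sZ; rewrite (nabla_addr LC sX sY (smooth_vfieldN sZ)).
by rewrite nablaNr.
Qed.

Lemma nablaBl X Y Z : smooth_vfield X -> smooth_vfield Y -> smooth_vfield Z ->
  nabla (X \- Y) Z = nabla X Z \- nabla Y Z.
Proof.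
move=> sX sY sZ; rewrite (nabla_addl LC sX (smooth_vfieldN sY) sZ).
by rewrite nablaNl.
Qed.

Lemma bracketE X Y : smooth_vfield X -> smooth_vfield Y ->
  bracket X Y = nabla X Y \- nabla Y X.
Proof. by move=> sX sY; rewrite (nabla_torsion_free LC). Qed.

(** Torsion-freeness writes the bracket as a difference of covariant derivatives, whose smoothness
    is given; no computation in charts is involved. *)
Lemma smooth_bracket X Y : smooth_vfield X -> smooth_vfield Y ->
  smooth_vfield (bracket X Y).
Proof.
move=> sX sY; rewrite (bracketE sX sY).
exact: smooth_vfieldB (nabla_smooth LC sX sY) (nabla_smooth LC sY sX).
Qed.

Lemma bracketNr X Y : smooth_vfield X -> smooth_vfield Y ->
  bracket X (\- Y) = \- bracket X Y.
Proof.
move=> sX sY; rewrite (bracketE sX (smooth_vfieldN sY)) (bracketE sX sY).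
by rewrite (nablaNr sX sY) (nablaNl sY sX); apply/funext => x; rewrite /= opprD.
Qed.

(** As derivations, brackets are commutators, and the twelve third-order terms cancel in pairs. *)
Lemma jacobi X Y Z x : smooth_vfield X -> smooth_vfield Y -> smooth_vfield Z ->
  bracket X (bracket Y Z) x + bracket Y (bracket Z X) x + bracket Z (bracket X Y) x = 0.
Proof.
move=> sX sY sZ.
apply: (@vector_dirderP _ _ _ x
  (bracket X (bracket Y Z) \+ bracket Y (bracket Z X) \+ bracket Z (bracket X Y))
  (fun _ => 0)) => f sf.
rewrite 2!(dirderDl _ _ sf) dirder0l /=.
have sB U V : smooth_vfield U -> smooth_vfield V -> smooth_vfield (bracket U V).
  exact: smooth_bracket.
have H U V W : smooth_vfield U -> smooth_vfield V -> smooth_vfield W ->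
    dirder (bracket U (bracket V W)) f x =
    dirder U (dirder V (dirder W f)) x - dirder U (dirder W (dirder V f)) x
    - dirder V (dirder W (dirder U f)) x + dirder W (dirder V (dirder U f)) x.
  move=> sU sV sW; have sd := @dirder_smooth R m M.
  rewrite (bracket_dirder sU (sB V W sV sW) sf) (bracket_dirder sV sW sf).
  rewrite (bracket_dirder sV sW (sd _ _ sU sf)).
  rewrite (dirderB U (sd _ _ sV (sd _ _ sW sf)) (sd _ _ sW (sd _ _ sV sf))) /=.
  by generalize_dirder; ring.
move: (H X Y Z sX sY sZ) (H Y Z X sY sZ sX) (H Z X Y sZ sX sY).
generalize_dirder.
lra.
Qed.

Lemma bianchi X Y Z x : smooth_vfield X -> smooth_vfield Y -> smooth_vfield Z ->
  curvature nabla X Y Z x + curvature nabla Y Z X x + curvature nabla Z X Y x = 0.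
Proof.
move=> sX sY sZ; have sn := nabla_smooth LC; have sB := smooth_bracket.
rewrite -(jacobi x sX sY sZ).
have H U V W : smooth_vfield U -> smooth_vfield V -> smooth_vfield W ->
    bracket U (bracket V W) x =
    nabla U (nabla V W) x - nabla U (nabla W V) x - nabla (bracket V W) U x.
  move=> sU sV sW; rewrite (bracketE sU (sB _ _ sV sW)) /= {1}(bracketE sV sW).
  by rewrite (nablaBr sU (sn _ _ sV sW) (sn _ _ sW sV)).
rewrite (H X Y Z sX sY sZ) (H Y Z X sY sZ sX) (H Z X Y sZ sX sY) /curvature /=.
generalize_vfield nabla.
by apply/rowP => j; rewrite !mxE; ring.
Qed.

Lemma met_nabla X Y Z x : smooth_vfield X -> smooth_vfield Y -> smooth_vfield Z ->
  dirder X (met g Y Z) x = met g (nabla X Y) Z x + met g Y (nabla X Z) x.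
Proof. by move=> sX sY sZ; rewrite (nabla_metric LC). Qed.

(** Both sides of [X, Y] = X Y - Y X are applied to the function g(Z, W). The products of first
    covariant derivatives are symmetric in X and Y and drop out. *)
Lemma met_curvatureC X Y Z W x :
  smooth_vfield X -> smooth_vfield Y -> smooth_vfield Z -> smooth_vfield W ->
  met g (curvature nabla X Y Z) W x = - met g Z (curvature nabla X Y W) x.
Proof.
move=> sX sY sZ sW; have sn := nabla_smooth LC; have sB := smooth_bracket.
have second U V : smooth_vfield U -> smooth_vfield V ->
    dirder U (dirder V (met g Z W)) x =
    met g (nabla U (nabla V Z)) W x + met g (nabla V Z) (nabla U W) x
    + met g (nabla U Z) (nabla V W) x + met g Z (nabla U (nabla V W)) x.
  move=> sU sV; have [sVZ sVW] := (sn _ _ sV sZ, sn _ _ sV sW).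
  rewrite (nabla_metric LC sV sZ sW).
  rewrite (dirderD U (smooth_met sVZ sW) (smooth_met sZ sVW)) /=.
  by rewrite (met_nabla _ sU sVZ sW) (met_nabla _ sU sZ sVW) addrA.
have := congr1 (@^~ x) (bracket_dirder sX sY (smooth_met sZ sW)).
rewrite /= (second X Y sX sY) (second Y X sY sX) (met_nabla _ (sB _ _ sX sY) sZ sW).
rewrite /met /curvature /= !met_atE; generalize_met; lra.
Qed.

End LeviCivita.

(** * Sasakian identities *)

Section SasakianIdentities.
Context {R : realType} {n : nat} {M : manifold R (2 * n).+1}.
Context {phi g : M -> 'M[R]_((2 * n).+1)} {xi : vfield M}
  {eta : M -> 'cV[R]_((2 * n).+1)} {nabla : vfield M -> vfield M -> vfield M}.
Context (hS : sasakian phi xi eta g) (LC : levi_civita g nabla).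
Implicit Types (X Y Z W : vfield M) (f h : M -> R) (x : M).

Let acm : almost_contact_metric phi xi eta g := hS.1.1.
Let gP : riemannian_metric g := acm_metric acm.
Let sxi : smooth_vfield xi := acm_xi_smooth acm.
Let sphi X (sX : smooth_vfield X) : smooth_vfield (endo phi X) := acm_phi_smooth acm sX.
Let sn X Y (sX : smooth_vfield X) (sY : smooth_vfield Y) : smooth_vfield (nabla X Y) :=
  nabla_smooth LC sX sY.
Let sB X Y (sX : smooth_vfield X) (sY : smooth_vfield Y) : smooth_vfield (bracket X Y) :=
  smooth_bracket LC sX sY.

Lemma endo_atD x u v : endo_at phi x (u + v) = endo_at phi x u + endo_at phi x v.
Proof. by rewrite /endo_at mulmxDl. Qed.

Lemma endo_atN x u : endo_at phi x (- u) = - endo_at phi x u.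
Proof. by rewrite /endo_at mulNmx. Qed.

Lemma form_eta X : form eta X = met g X xi.
Proof. by apply/funext => x; rewrite /form /met (acm_eta_dual acm). Qed.

Lemma endo_xi : endo phi xi = fun _ => 0.
Proof. by apply/funext => x; exact: (acm_phi_xi acm). Qed.

Lemma met_xi_xi : met g xi xi = cst 1.
Proof.
by apply/funext => x; rewrite /met (acm_eta_dual acm) (acm_eta_xi acm).
Qed.

Lemma met_endo_xi X : met g (endo phi X) xi = cst 0.
Proof. by apply/funext => x; rewrite /met (acm_eta_dual acm) (acm_eta_phi acm). Qed.

Lemma met_endo X Y : met g X (endo phi Y) = \- met g (endo phi X) Y.
Proof. by apply/funext => x; exact: (acm_skew acm). Qed.

Lemma met_endo2 X Y : met g X (endo phi (endo phi Y)) =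
  (met g X xi \* met g Y xi) \- met g X Y.
Proof.
apply/funext => x; rewrite /met /endo /= (acm_phi2 acm) !met_atE.
by rewrite -(acm_eta_dual acm) addrC (mulrC (met_at _ _ _ _)).
Qed.

Lemma contactE X Y x : smooth_vfield X -> smooth_vfield Y ->
  2 * met g X (endo phi Y) x =
  dirder X (met g Y xi) x - dirder Y (met g X xi) x - met g (bracket X Y) xi x.
Proof.
move=> sX sY; have [_ H] := hS.1; rewrite -(H X Y sX sY) /d_form !form_eta.
by rewrite mulrA mulfV ?mul1r.
Qed.

(** In the contact condition at (xi, X), phi xi = 0 kills the left side and eta(xi) is constant.
    What remains is L_xi eta = 0. *)
Lemma met_bracket_xi X : smooth_vfield X ->
  met g (bracket xi X) xi = dirder xi (met g X xi).
Proof.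
move=> sX; apply/funext => x; have := contactE x sxi sX.
rewrite met_xi_xi dirder_cst /= met_endo /= endo_xi {1}/met.
rewrite /met_at !mul0mx mxE.
by generalize_dirder; generalize (met g (bracket xi X) xi x); intros; lra.
Qed.

(** Normality at (xi, X) reduces to phi d = 0 for d = phi [xi, X] - [xi, phi X]. Since L_xi eta = 0
    also gives eta(d) = 0, and phi^2 = -1 on the kernel of eta, d vanishes; this is L_xi phi = 0. *)
Lemma endo_bracket_xi X : smooth_vfield X ->
  bracket xi (endo phi X) = endo phi (bracket xi X).
Proof.
move=> sX; apply/funext => x.
have := hS.2 xi X sxi sX x.
have -> : d_form eta xi X x = 0.
  rewrite (hS.1.2 xi X sxi sX) met_endo /= endo_xi /met /met_at.
  by rewrite !mul0mx mxE oppr0.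
rewrite mulr0 scale0r add0r /nijenhuis endo_xi !bracket0l addr0.
have -> : endo phi (fun _ => 0) x = 0 by rewrite /endo /endo_at mul0mx.
rewrite subr0.
have E1 : met_at g x (bracket xi (endo phi X) x) (xi x) = 0.
  have := congr1 (@^~ x) (met_bracket_xi (sphi sX)).
  by rewrite met_endo_xi dirder_cst.
rewrite /endo; move: E1; move: (bracket xi (endo phi X) x) (bracket xi X x).
move=> u w E1 E2; pose d := endo_at phi x w - u.
have dphi : endo_at phi x d = 0 by rewrite endo_atD endo_atN.
have deta : form_at eta x d = 0.
  rewrite -(acm_eta_dual acm) met_atDl met_atNl E1 subr0.
  by rewrite (acm_eta_dual acm) (acm_eta_phi acm).
have := acm_phi2 acm x d; rewrite dphi deta scale0r addr0 {1}/endo_at mul0mx.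
by move=> /esym/eqP; rewrite oppr_eq0 subr_eq0 => /eqP.
Qed.

(** This is L_xi (d eta) = 0: the Lie derivative commutes with d and annihilates eta. The Jacobi
    identity takes care of the term eta([X, Y]). *)
Lemma dform_xi X Y x : smooth_vfield X -> smooth_vfield Y ->
  dirder xi (met g X (endo phi Y)) x =
  met g (bracket xi X) (endo phi Y) x + met g X (endo phi (bracket xi Y)) x.
Proof.
move=> sX sY; have sxX := sB sxi sX; have sxY := sB sxi sY.
have sXx := smooth_met gP sX sxi; have sYx := smooth_met gP sY sxi.
have sm Z (sZ : smooth_vfield Z) := smooth_met gP sZ sxi.
have sd Z f := @dirder_smooth R _ M Z f.
have EF : 2%:R \*o met g X (endo phi Y) =
    dirder X (met g Y xi) \- dirder Y (met g X xi) \- met g (bracket X Y) xi.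
  by apply/funext => y; exact: contactE.
have := congr1 (fun F => dirder xi F x) EF.
have -> : (2%:R \*o met g X (endo phi Y)) = cst 2%:R \* met g X (endo phi Y) by [].
rewrite (dirderM _ (smooth_fun_cst _) (smooth_met gP sX (sphi sY))) dirder_cst.
rewrite (dirderB _ (smooth_funB (sd _ _ sX sYx) (sd _ _ sY sXx)) (sm _ (sB sX sY))).
rewrite (dirderB _ (sd _ _ sX sYx) (sd _ _ sY sXx)) /= mul0r add0r.
have com Z f : smooth_vfield Z -> smooth_fun f ->
    dirder xi (dirder Z f) x = dirder (bracket xi Z) f x + dirder Z (dirder xi f) x.
  move=> sZ sf; rewrite (bracket_dirder sxi sZ sf) /=.
  by generalize_dirder; intros; ring.
have := contactE x sxX sY; have := contactE x sX sxY.
have J : met g (bracket xi (bracket X Y)) xi x =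
    met g (bracket (bracket xi X) Y) xi x + met g (bracket X (bracket xi Y)) xi x.
  have := jacobi LC x sxi sX sY.
  rewrite (bracketC Y xi) (bracketNr LC sX sxY) (bracketC Y (bracket xi X)) /met /=.
  generalize_bracket.
  move=> /(congr1 (fun u => met_at g x u (xi x))).
  rewrite met_at0l !met_atE.
  by generalize_met; intros; lra.
have cX := com _ _ sX sYx; have cY := com _ _ sY sXx.
have cB := congr1 (@^~ x) (met_bracket_xi (sB sX sY)).
rewrite -(endo_bracket_xi sY).
move: cX cY J cB (met_bracket_xi sX) (met_bracket_xi sY) => /=.
generalize_bracket => cX cY J cB eX eY; move: cX cY J cB.
rewrite eX eY.
by generalize_dirder; generalize_vfield (met g); intros; lra.
Qed.

(** Since phi^2 turns d eta(X, phi Y) into eta(X) eta(Y) - g(X, Y), the invariance of eta, phi and d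
    eta under xi passes to g. *)
Lemma xi_killing X Y x : smooth_vfield X -> smooth_vfield Y ->
  dirder xi (met g X Y) x = met g (bracket xi X) Y x + met g X (bracket xi Y) x.
Proof.
move=> sX sY; have := dform_xi x sX (sphi sY).
rewrite (endo_bracket_xi sY) !met_endo2.
have sm Z (sZ : smooth_vfield Z) := smooth_met gP sZ sxi.
rewrite (dirderB _ (smooth_funM (sm _ sX) (sm _ sY)) (smooth_met gP sX sY)).
rewrite (dirderM _ (sm _ sX) (sm _ sY)) /=.
move: (met_bracket_xi sX) (met_bracket_xi sY).
generalize_bracket => eX eY; rewrite eX eY.
by generalize_dirder; generalize_vfield (met g); intros; lra.
Qed.

(** The Killing property makes g(nabla_X xi, Y) skew in X and Y, and the contact condition computes
    its skew part as g(X, phi Y) = - g(phi X, Y). *)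
Lemma nabla_xi X : smooth_vfield X -> nabla X xi = \- endo phi X.
Proof.
move=> sX; apply/funext => x; apply: (met_at_inj gP (x := x)) => Y sY.
have := xi_killing x sX sY; have := contactE x sX sY.
rewrite (met_nabla LC x sX sY sxi) (met_nabla LC x sY sX sxi) (met_nabla LC x sxi sX sY).
rewrite (bracketE LC sX sY) (bracketE LC sxi sX) (bracketE LC sxi sY) met_endo.
rewrite /met /= !met_atE (met_atC gP x (X x) (nabla Y xi x)).
rewrite (met_atC gP x (Y x) (nabla X xi x)).
by generalize_met; intros; lra.
Qed.

(** The covariant derivative (nabla_X phi) Y of the tensor phi. *)
Definition nabla_endo X Y : vfield M :=
  nabla X (endo phi Y) \- endo phi (nabla X Y).

Lemma met_nabla_endo X Y Z x :
  smooth_vfield X -> smooth_vfield Y -> smooth_vfield Z ->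
  met g (nabla_endo X Y) Z x = - met g (nabla_endo X Z) Y x.
Proof.
move=> sX sY sZ; have := met_nabla LC x sX (sphi sY) sZ.
have := met_nabla LC x sX sY (sphi sZ); rewrite met_endo.
rewrite (dirderN _ (smooth_met gP (sphi sY) sZ)) /= /met /nabla_endo /= !met_atE.
have := acm_skew acm x (nabla X Y x) (Z x); have := acm_skew acm x (nabla X Z x) (Y x).
rewrite (met_atC gP x (Y x) (nabla X (endo phi Z) x)) /endo.
rewrite (met_atC gP x (nabla X Z x) (endo_at phi x (Y x))).
by generalize_dirder; generalize_met; intros; lra.
Qed.

Lemma curvature_xi X Y : smooth_vfield X -> smooth_vfield Y ->
  curvature nabla X Y xi = nabla_endo Y X \- nabla_endo X Y.
Proof.
move=> sX sY; rewrite /curvature (nabla_xi sX) (nabla_xi sY) (nabla_xi (sB sX sY)).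
rewrite (nablaNr LC sX (sphi sY)) (nablaNr LC sY (sphi sX)) (bracketE LC sX sY).
apply/funext => x; rewrite /nabla_endo /= /endo endo_atD endo_atN.
generalize_vfield nabla; intros; apply/rowP => j; rewrite !mxE.
by ring.
Qed.

(** This is the closedness of the 2-form d eta, obtained from the first Bianchi identity: pairing
    R(U, V) W with xi gives two of the three cyclic terms, so the cyclic sum counts every term
    twice. *)
Lemma nabla_endo_cyclic X Y Z x :
  smooth_vfield X -> smooth_vfield Y -> smooth_vfield Z ->
  met g (nabla_endo X Y) Z x + met g (nabla_endo Y Z) X x
    + met g (nabla_endo Z X) Y x = 0.
Proof.
move=> sX sY sZ.
have H U V W : smooth_vfield U -> smooth_vfield V -> smooth_vfield W ->
    met g (nabla_endo U V) W x + met g (nabla_endo V W) U x =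
    met g xi (curvature nabla U V W) x.
  move=> sU sV sW; have := met_curvatureC gP LC x sU sV sxi sW.
  rewrite (curvature_xi sU sV); have := met_nabla_endo x sV sU sW.
  by rewrite /met /= !met_atE; generalize_met; intros; lra.
have : met g xi (curvature nabla X Y Z) x + met g xi (curvature nabla Y Z X) x
    + met g xi (curvature nabla Z X Y) x = 0.
  by rewrite /met -!met_atDr (bianchi LC x sX sY sZ) met_at0r.
have := H _ _ _ sX sY sZ; have := H _ _ _ sY sZ sX; have := H _ _ _ sZ sX sY.
rewrite /met.
by generalize_met; intros; lra.
Qed.

Lemma nijenhuis_nabla X Y x : smooth_vfield X -> smooth_vfield Y ->
  nijenhuis phi X Y x =
  nabla_endo (endo phi X) Y x - nabla_endo (endo phi Y) X x
  - endo_at phi x (nabla_endo X Y x) + endo_at phi x (nabla_endo Y X x).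
Proof.
move=> sX sY; rewrite /nijenhuis.
rewrite (bracketE LC sX sY) (bracketE LC (sphi sX) (sphi sY)).
rewrite (bracketE LC (sphi sX) sY) (bracketE LC sX (sphi sY)).
rewrite /nabla_endo /endo /=; generalize_vfield nabla; intros.
rewrite !endo_atD !endo_atN.
by generalize_endo; intros; apply/rowP => j; rewrite !mxE; ring.
Qed.

Lemma normality_nabla X Y Z x :
  smooth_vfield X -> smooth_vfield Y -> smooth_vfield Z ->
  met g (nabla_endo (endo phi X) Y) Z x - met g (nabla_endo (endo phi Y) X) Z x
  + met g (nabla_endo X Y) (endo phi Z) x - met g (nabla_endo Y X) (endo phi Z) x
  = - 2 * met g X (endo phi Y) x * met g Z xi x.
Proof.
move=> sX sY sZ; have := congr1 (fun u => met_at g x u (Z x)) (hS.2 X Y sX sY x).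
rewrite (hS.1.2 X Y sX sY) (nijenhuis_nabla x sX sY) met_at0l /met /endo.
generalize_vfield nabla_endo.
rewrite !met_atE !(acm_skew acm) (met_atC gP x (xi x)).
by generalize_met; intros; lra.
Qed.

(* Polarizing the normality identity with the cyclic identity determines
   nabla phi along the contact distribution. *)
Lemma nabla_endo_horizontal X Y Z x :
  smooth_vfield X -> smooth_vfield Y -> smooth_vfield Z ->
  met g (nabla_endo (endo phi X) Y) Z x =
  met g X (endo phi Z) x * met g Y xi x - met g X (endo phi Y) x * met g Z xi x.
Proof.
move=> sX sY sZ.
have H U V W : smooth_vfield U -> smooth_vfield V -> smooth_vfield W ->
    met g (nabla_endo (endo phi U) V) W x =
    met g (nabla_endo (endo phi V) U) W x + met g (nabla_endo (endo phi W) U) V x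
    - 2 * met g U (endo phi V) x * met g W xi x.
  move=> sU sV sW; have := normality_nabla x sU sV sW.
  have := nabla_endo_cyclic x sU sV (sphi sW).
  have := met_nabla_endo x sV (sphi sW) sU.
  by generalize_vfield (met g); intros; lra.
(* Exchanging Y and Z leaves the first two terms on the right of H unchanged as a sum, while the
   left side changes sign by skewness; subtraction isolates it. *)
have := H _ _ _ sX sY sZ; have := H _ _ _ sX sZ sY.
have := met_nabla_endo x (sphi sX) sY sZ.
by generalize_vfield (met g); intros; lra.
Qed.

(** Once nabla xi = - phi is inserted in [xi, phi X] = phi [xi, X], both sides contain phi^2 X;
    cancelling it leaves the claim. *)
Lemma nabla_endo_xi X x : smooth_vfield X -> nabla_endo xi X x = 0.
Proof.
move=> sX; have := congr1 (@^~ x) (endo_bracket_xi sX).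
rewrite (bracketE LC sxi (sphi sX)) (bracketE LC sxi sX).
rewrite (nabla_xi sX) (nabla_xi (sphi sX)) /nabla_endo /= /endo.
rewrite !endo_atD !endo_atN.
by move=> /addIr ->; rewrite subrr.
Qed.

(** With a horizontal second argument, the formula for nabla phi keeps only - g(X, phi^2 Y) eta(Z),
    which is symmetric in X and Y, whereas the curvature takes the skew part. *)
Lemma curvature_endo_endo_xi X Y x : smooth_vfield X -> smooth_vfield Y ->
  curvature nabla (endo phi X) (endo phi Y) xi x = 0.
Proof.
move=> sX sY; rewrite (curvature_xi (sphi sX) (sphi sY)).
apply: (met_at_inj gP (x := x)) => Z sZ.
have := nabla_endo_horizontal x sX (sphi sY) sZ.
have := nabla_endo_horizontal x sY (sphi sX) sZ.
rewrite !met_endo_xi !met_endo2 /= met_at0l met_atDl met_atNl /met.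
rewrite (met_atC gP x (Y x) (X x)).
by generalize_met; intros; lra.
Qed.

Lemma curvature_xi_endo_xi X x : smooth_vfield X ->
  curvature nabla xi (endo phi X) xi x = - endo phi X x.
Proof.
move=> sX; rewrite (curvature_xi sxi (sphi sX)) /=.
rewrite (nabla_endo_xi x (sphi sX)) subr0.
apply: (met_at_inj gP (x := x)) => Z sZ.
have := nabla_endo_horizontal x sX sxi sZ.
rewrite met_xi_xi endo_xi !met_endo /met /= met_at0r met_atNl.
by generalize_met; intros; lra.
Qed.

End SasakianIdentities.

Lemma mulmx_row_inj (R : pzRingType) m p (A B : 'M[R]_(m, p)) :
  (forall u : 'rV_m, u *m A = u *m B) -> A = B.
Proof. by move=> H; apply/row_matrixP => i; rewrite !rowE H. Qed.

(** * Matrices and traces of tensorial maps *)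

Section Trace.
Context {R : realType} {m : nat} {M : manifold R m}.
Implicit Types (X Y Z W U V : vfield M) (f h : M -> R) (x : M).

Lemma tensorial_mx x (T : vfield M -> vfield M) :
  (forall X Y, smooth_vfield X -> smooth_vfield Y -> T (X \+ Y) x = T X x + T Y x) ->
  (forall f X, smooth_fun f -> smooth_vfield X -> T (scalef f X) x = f x *: T X x) ->
  exists A : 'M[R]_m, forall X, smooth_vfield X -> T X x = X x *m A.
Proof.
move=> TD TZ; have [t tE] := tensorial_at (T := fun X => T X x) TD TZ.
exists (\matrix_j t j) => X sX; rewrite (tE X sX) mulmx_sum_row.
by apply: eq_bigr => j _; rewrite rowK.
Qed.

(** Every row is the value at x of a smooth field, so at most one matrix represents T and [xget]
    returns A instead of its default. *)
Lemma trace_fieldE x (T : vfield M -> vfield M) (A : 'M[R]_m) :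
  (forall X, smooth_vfield X -> T X x = X x *m A) -> trace_field T x = \tr A.
Proof.
move=> TA; rewrite /trace_field; congr (\tr _).
case: xgetP => [B _ TB|/(_ A)]; last by case.
apply: mulmx_row_inj => u; have [X [sX <-]] := vfield_at x u.
by rewrite -(TA X sX) -(TB X sX).
Qed.

End Trace.

(** * Tensoriality of the curvature, the Ricci tensor and the Ricci operator *)

Section CurvatureTensor.
Context {R : realType} {m : nat} {M : manifold R m}.
Context {g : M -> 'M[R]_m} {nabla : vfield M -> vfield M -> vfield M}.
Context (gP : riemannian_metric g) (LC : levi_civita g nabla).
Implicit Types (X Y Z W U V : vfield M) (f h : M -> R) (x : M).

Let sn X Y (sX : smooth_vfield X) (sY : smooth_vfield Y) : smooth_vfield (nabla X Y) :=
  nabla_smooth LC sX sY.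
Let sB X Y (sX : smooth_vfield X) (sY : smooth_vfield Y) : smooth_vfield (bracket X Y) :=
  smooth_bracket LC sX sY.

Lemma curvatureC X Y Z x : smooth_vfield X -> smooth_vfield Y -> smooth_vfield Z ->
  curvature nabla X Y Z x = - curvature nabla Y X Z x.
Proof.
move=> sX sY sZ; rewrite /curvature (bracketC X Y) (nablaNl LC (sB sY sX) sZ) /=.
generalize_vfield nabla; intros; apply/rowP => j; rewrite !mxE.
by ring.
Qed.

Lemma bracketDl X Y Z : smooth_vfield X -> smooth_vfield Y -> smooth_vfield Z ->
  bracket (X \+ Y) Z = bracket X Z \+ bracket Y Z.
Proof.
move=> sX sY sZ; rewrite (bracketE LC (smooth_vfieldD sX sY) sZ).
rewrite (bracketE LC sX sZ) (bracketE LC sY sZ).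
rewrite (nabla_addl LC sX sY sZ) (nabla_addr LC sZ sX sY); apply/funext => x /=.
generalize_vfield nabla; intros; apply/rowP => j; rewrite !mxE.
by ring.
Qed.

Lemma bracketZl f X Y : smooth_fun f -> smooth_vfield X -> smooth_vfield Y ->
  bracket (scalef f X) Y = scalef f (bracket X Y) \- scalef (dirder Y f) X.
Proof.
move=> sf sX sY; rewrite (bracketE LC (smooth_vfieldZ sf sX) sY) (bracketE LC sX sY).
rewrite (nabla_scalel LC sf sX sY) (nabla_leibniz LC sf sY sX).
apply/funext => x; rewrite /scalef /=.
generalize_vfield nabla; generalize_dirder; intros; apply/rowP => j; rewrite !mxE.
by ring.
Qed.

Lemma curvatureDl X Y Z W x :
  smooth_vfield X -> smooth_vfield Y -> smooth_vfield Z -> smooth_vfield W ->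
  curvature nabla (X \+ Y) Z W x = curvature nabla X Z W x + curvature nabla Y Z W x.
Proof.
move=> sX sY sZ sW; rewrite /curvature (bracketDl sX sY sZ).
rewrite (nabla_addl LC (sB sX sZ) (sB sY sZ) sW) (nabla_addl LC sX sY (sn sZ sW)).
rewrite (nabla_addl LC sX sY sW) (nabla_addr LC sZ (sn sX sW) (sn sY sW)) /=.
generalize_vfield nabla; intros; apply/rowP => j; rewrite !mxE.
by ring.
Qed.

Lemma curvatureZl f X Y Z x : smooth_fun f ->
  smooth_vfield X -> smooth_vfield Y -> smooth_vfield Z ->
  curvature nabla (scalef f X) Y Z x = f x *: curvature nabla X Y Z x.
Proof.
move=> sf sX sY sZ; have sYf := dirder_smooth sY sf.
rewrite /curvature (bracketZl sf sX sY).
rewrite (nablaBl LC (smooth_vfieldZ sf (sB sX sY)) (smooth_vfieldZ sYf sX) sZ).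
rewrite (nabla_scalel LC sf (sB sX sY) sZ) (nabla_scalel LC sYf sX sZ).
rewrite (nabla_scalel LC sf sX (sn sY sZ)) (nabla_scalel LC sf sX sZ).
rewrite (nabla_leibniz LC sf sY (sn sX sZ)) /scalef /=.
generalize_vfield nabla; generalize_dirder; intros; apply/rowP => j; rewrite !mxE.
by ring.
Qed.

Lemma curvatureDr X Y Z W x :
  smooth_vfield X -> smooth_vfield Y -> smooth_vfield Z -> smooth_vfield W ->
  curvature nabla X Y (Z \+ W) x = curvature nabla X Y Z x + curvature nabla X Y W x.
Proof.
move=> sX sY sZ sW; rewrite /curvature (nabla_addr LC (sB sX sY) sZ sW).
rewrite (nabla_addr LC sX sZ sW) (nabla_addr LC sY sZ sW).
rewrite (nabla_addr LC sX (sn sY sZ) (sn sY sW)) (nabla_addr LC sY (sn sX sZ) (sn sX sW)) /=.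
generalize_vfield nabla; intros; apply/rowP => j; rewrite !mxE.
by ring.
Qed.

(** Second derivatives of f occur as X (Y f) - Y (X f) and are cancelled by [X, Y] f; the mixed
    first-order terms are symmetric in X and Y. *)
Lemma curvatureZr f X Y Z x : smooth_fun f ->
  smooth_vfield X -> smooth_vfield Y -> smooth_vfield Z ->
  curvature nabla X Y (scalef f Z) x = f x *: curvature nabla X Y Z x.
Proof.
move=> sf sX sY sZ.
have [sXf sYf] := (dirder_smooth sX sf, dirder_smooth sY sf).
have H U V : smooth_vfield U -> smooth_vfield V ->
    nabla U (nabla V (scalef f Z)) x =
    dirder U (dirder V f) x *: Z x + dirder V f x *: nabla U Z x
    + dirder U f x *: nabla V Z x + f x *: nabla U (nabla V Z) x.
  move=> sU sV; have sVf := dirder_smooth sV sf.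
  rewrite (nabla_leibniz LC sf sV sZ).
  rewrite (nabla_addr LC sU (smooth_vfieldZ sVf sZ) (smooth_vfieldZ sf (sn sV sZ))).
  rewrite (nabla_leibniz LC sVf sU sZ) (nabla_leibniz LC sf sU (sn sV sZ)).
  by rewrite /scalef /= !addrA.
have E1 := H X Y sX sY; have E2 := H Y X sY sX.
rewrite /curvature (nabla_leibniz LC sf (sB sX sY) sZ) (bracket_dirder sX sY sf).
move: E1 E2; rewrite /scalef /=.
generalize_vfield nabla; generalize_dirder => -> ->; apply/rowP => j; rewrite !mxE.
by ring.
Qed.

Lemma curvature_mx1 Y Z x : smooth_vfield Y -> smooth_vfield Z ->
  exists A, forall X, smooth_vfield X -> curvature nabla X Y Z x = X x *m A.
Proof.
move=> sY sZ; apply: (tensorial_mx (T := fun X => curvature nabla X Y Z)).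
  by move=> U V sU sV; exact: curvatureDl.
by move=> f U sf sU; exact: curvatureZl.
Qed.

Lemma curvature_mx3 X Y x : smooth_vfield X -> smooth_vfield Y ->
  exists A, forall Z, smooth_vfield Z -> curvature nabla X Y Z x = Z x *m A.
Proof.
move=> sX sY; apply: (tensorial_mx (T := fun Z => curvature nabla X Y Z)).
  by move=> U V sU sV; exact: curvatureDr.
by move=> f U sf sU; exact: curvatureZr.
Qed.

Lemma ricciE Y Z x (A : 'M[R]_m) :
  (forall X, smooth_vfield X -> curvature nabla X Y Z x = X x *m A) ->
  ricci nabla Y Z x = \tr A.
Proof. exact: (trace_fieldE (T := fun X => curvature nabla X Y Z)). Qed.

Lemma ricciDl Y Y' Z x : smooth_vfield Y -> smooth_vfield Y' -> smooth_vfield Z ->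
  ricci nabla (Y \+ Y') Z x = ricci nabla Y Z x + ricci nabla Y' Z x.
Proof.
move=> sY sY' sZ; have [A AE] := curvature_mx1 x sY sZ.
have [A' AE'] := curvature_mx1 x sY' sZ.
rewrite (ricciE AE) (ricciE AE') -mxtraceD; apply: ricciE => X sX.
have sYY := smooth_vfieldD sY sY'; rewrite mulmxDr -(AE X sX) -(AE' X sX).
rewrite (curvatureC x sX sYY sZ) (curvatureDl x sY sY' sX sZ).
by rewrite (curvatureC x sX sY sZ) (curvatureC x sX sY' sZ) opprD.
Qed.

Lemma ricciZl f Y Z x : smooth_fun f -> smooth_vfield Y -> smooth_vfield Z ->
  ricci nabla (scalef f Y) Z x = f x * ricci nabla Y Z x.
Proof.
move=> sf sY sZ; have [A AE] := curvature_mx1 x sY sZ.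
rewrite (ricciE AE) -mxtraceZ; apply: ricciE => X sX.
rewrite -scalemxAr -(AE X sX) (curvatureC x sX (smooth_vfieldZ sf sY) sZ).
by rewrite (curvatureZl x sf sY sX sZ) (curvatureC x sX sY sZ) scalerN.
Qed.

Lemma ricciDr Y Z Z' x : smooth_vfield Y -> smooth_vfield Z -> smooth_vfield Z' ->
  ricci nabla Y (Z \+ Z') x = ricci nabla Y Z x + ricci nabla Y Z' x.
Proof.
move=> sY sZ sZ'; have [A AE] := curvature_mx1 x sY sZ.
have [A' AE'] := curvature_mx1 x sY sZ'.
rewrite (ricciE AE) (ricciE AE') -mxtraceD; apply: ricciE => X sX.
by rewrite mulmxDr -(AE X sX) -(AE' X sX); exact: curvatureDr.
Qed.

Lemma ricciZr f Y Z x : smooth_fun f -> smooth_vfield Y -> smooth_vfield Z ->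
  ricci nabla Y (scalef f Z) x = f x * ricci nabla Y Z x.
Proof.
move=> sf sY sZ; have [A AE] := curvature_mx1 x sY sZ.
rewrite (ricciE AE) -mxtraceZ; apply: ricciE => X sX.
by rewrite -scalemxAr -(AE X sX); exact: curvatureZr.
Qed.

Lemma metric_unit x : g x \in unitmx.
Proof.
rewrite -row_free_unit; apply: inj_row_free => u uG.
apply/eqP; apply/negP => /negP u0; have [_ _ /(_ x u u0)] := gP.
by rewrite /met_at uG mul0mx mxE ltxx.
Qed.

(** The Ricci tensor at x is a linear form in Y, and the invertible matrix of g represents it by a
    vector; so [xget] picks a genuine dual and not its default. *)
Lemma met_ricci_operator X Y x : smooth_vfield X -> smooth_vfield Y ->
  met_at g x (ricci_operator g nabla X x) (Y x) = ricci nabla X Y x.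
Proof.
move=> sX; move: Y.
have [t tE] := tensorial_at (x := x) (W := R^o) (T := fun Y => ricci nabla X Y x)
  (fun U V sU sV => ricciDr x sX sU sV) (fun f U sf sU => ricciZr x sf sX sU).
have [v vE] : exists v, forall Y, smooth_vfield Y ->
    ricci nabla X Y x = met_at g x v (Y x).
  exists ((\row_j t j) *m invmx (g x)) => Y sY.
  rewrite (tE Y sY) /met_at mulmxKV ?metric_unit // mxE.
  by apply: eq_bigr => j _; rewrite !mxE mulrC.
move=> Y sY; rewrite /ricci_operator.
by case: xgetP => [w _ wE|/(_ v)]; [rewrite (wE Y sY)|case].
Qed.

Lemma ricci_operator_mx x : exists Q, forall X, smooth_vfield X ->
  ricci_operator g nabla X x = X x *m Q.
Proof.
apply: (tensorial_mx (T := fun X => ricci_operator g nabla X)).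
  move=> U V sU sV; apply: (met_at_inj gP (x := x)) => Z sZ.
  have rU := met_ricci_operator x sU sZ; have rV := met_ricci_operator x sV sZ.
  apply: etrans (met_ricci_operator x (smooth_vfieldD sU sV) sZ) _.
  apply: etrans (ricciDl x sU sV sZ) _; rewrite met_atDl.
  by apply: congr2; apply: esym.
move=> f U sf sU; apply: (met_at_inj gP (x := x)) => Z sZ.
apply: etrans (met_ricci_operator x (smooth_vfieldZ sf sU) sZ) _.
apply: etrans (ricciZl x sf sU sZ) _; rewrite met_atZl.
by congr (_ * _); apply: esym; exact: met_ricci_operator.
Qed.

End CurvatureTensor.

(** * Projective flatness *)

Section ProjectivelyFlat.
Context {R : realType} {n : nat} {M : manifold R (2 * n).+1}.
Context {phi g : M -> 'M[R]_((2 * n).+1)} {xi : vfield M}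
  {eta : M -> 'cV[R]_((2 * n).+1)} {nabla : vfield M -> vfield M -> vfield M}.
Context (hS : sasakian phi xi eta g) (LC : levi_civita g nabla).
Context (hF : phi_projectively_flat phi g nabla).
Implicit Types (X Y Z W : vfield M) (x : M) (u v w : 'rV[R]_((2 * n).+1)).

Let acm : almost_contact_metric phi xi eta g := hS.1.1.
Let gP : riemannian_metric g := acm_metric acm.
Let sxi : smooth_vfield xi := acm_xi_smooth acm.
Let sphi X (sX : smooth_vfield X) : smooth_vfield (endo phi X) := acm_phi_smooth acm sX.

(* The projection onto the contact distribution along xi. *)
Definition horizontal (eta : M -> 'cV[R]_((2 * n).+1)) (xi : vfield M) x :
  'M[R]_((2 * n).+1) := 1%:M - eta x *m xi x.

Local Notation P := (horizontal eta xi).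

Lemma mul_horizontal x u : u *m P x = u - form_at eta x u *: xi x.
Proof.
rewrite /horizontal mulmxBr mulmx1 mulmxA [u *m eta x]mx11_scalar.
by rewrite mul_scalar_mx.
Qed.

Lemma endo_at2 x u : endo_at phi x (endo_at phi x u) = - (u *m P x).
Proof. by rewrite mul_horizontal opprB addrC (acm_phi2 acm). Qed.

Lemma phi_sq x : phi x *m phi x = - P x.
Proof.
by apply: mulmx_row_inj => u; rewrite mulmxA mulmxN -endo_at2.
Qed.

Lemma phi_horizontal x : phi x *m P x = phi x.
Proof.
apply: mulmx_row_inj => u; rewrite mulmxA mul_horizontal.
by rewrite -[u *m phi x]/(endo_at phi x u) (acm_eta_phi acm) scale0r subr0.
Qed.

Lemma endo_horizontal Y x : endo phi Y x *m P x = endo phi Y x.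
Proof. by rewrite /endo /endo_at -mulmxA phi_horizontal. Qed.

Lemma horizontal_sq x : P x *m P x = P x.
Proof.
by rewrite -[X in X *m _ = _]opprK -phi_sq mulNmx -mulmxA phi_horizontal phi_sq opprK.
Qed.

Lemma trace_horizontal x : \tr (P x) = (2 * n)%:R.
Proof.
rewrite /horizontal linearB /= mxtrace1 mxtrace_mulC [xi x *m eta x]mx11_scalar.
rewrite -[(xi x *m eta x) 0 0]/(form_at eta x (xi x)) (acm_eta_xi acm).
by rewrite mxtrace1 -addn1 natrD addrK.
Qed.

Lemma met_horizontal x u v : form_at eta x v = 0 ->
  met_at g x (u *m P x) v = met_at g x u v.
Proof.
move=> v0; rewrite mul_horizontal met_atDl met_atNl met_atZl.
by rewrite (met_atC gP x (xi x)) (acm_eta_dual acm) v0 mulr0 subr0.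
Qed.

Lemma n_gt0 : (0 < n)%N. Proof. exact: acm_dim acm. Qed.

Lemma double_n_neq0 : (2 * n)%:R != 0 :> R.
Proof. by rewrite pnatr_eq0 muln_eq0 /= -lt0n n_gt0. Qed.

(** As phi^2 = -P, flatness sees only projections to D. The curvature term is already horizontal,
    since its pairing with xi moves over to R(phi X, phi Y) xi = 0; hence P survives only next to
    Q. *)
Lemma flat_curvature X Y Z x (Q : 'M[R]_((2 * n).+1)) :
  (forall X, smooth_vfield X -> ricci_operator g nabla X x = X x *m Q) ->
  smooth_vfield X -> smooth_vfield Y -> smooth_vfield Z ->
  curvature nabla (endo phi X) (endo phi Y) (endo phi Z) x =
  (2 * n)%:R^-1 *: (met g (endo phi Y) (endo phi Z) x *: (endo phi X x *m Q *m P x)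
                   - met g (endo phi X) (endo phi Z) x *: (endo phi Y x *m Q *m P x)).
Proof.
move=> QE sX sY sZ.
have K0 : form_at eta x (curvature nabla (endo phi X) (endo phi Y) (endo phi Z) x) = 0.
  rewrite -(acm_eta_dual acm).
  apply: etrans (met_curvatureC gP LC x (sphi sX) (sphi sY) (sphi sZ) sxi) _.
  by rewrite /met (curvature_endo_endo_xi hS LC x sX sY) met_at0r oppr0.
have : endo_at phi x (endo_at phi x (projective_curvature g nabla (endo phi X)
    (endo phi Y) (endo phi Z) x)) = 0 := hF.2 X Y Z sX sY sZ x.
rewrite /projective_curvature (QE _ (sphi sX)) (QE _ (sphi sY)).
move: K0; generalize (curvature nabla (endo phi X) (endo phi Y) (endo phi Z) x) => K K0.
rewrite endo_at2 => /eqP; rewrite oppr_eq0 => /eqP.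
rewrite !(mulmxBl, =^~ scalemxAl) => /eqP.
by rewrite subr_eq0 => /eqP <-; rewrite mul_horizontal K0 scale0r subr0.
Qed.

Lemma horizontalE x u : u *m P x = endo_at phi x (- endo_at phi x u).
Proof. by rewrite /endo_at mulNmx -mulmxA phi_sq mulmxN opprK. Qed.

(** The trace defining S is split along D and xi: D contributes the bracket divided by 2n through
    flatness, and xi contributes the last summand. *)
Lemma ricci_horizontal_trace Y Z x (Q : 'M[R]_((2 * n).+1)) :
  (forall X, smooth_vfield X -> ricci_operator g nabla X x = X x *m Q) ->
  smooth_vfield Y -> smooth_vfield Z ->
  met_at g x (endo phi Y x *m Q) (endo phi Z x) =
  (2 * n)%:R^-1 * (met g (endo phi Y) (endo phi Z) x * \tr (P x *m Q *m P x)
    - met_at g x (endo phi Y x *m Q) (endo phi Z x)) + met g (endo phi Y) (endo phi Z) x.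
Proof.
move=> QE sY sZ; set c := (2 * n)%:R^-1.
rewrite -{1}(QE _ (sphi sY)) (met_ricci_operator gP LC x (sphi sY) (sphi sZ)).
have [A AE] := curvature_mx1 LC x (sphi sY) (sphi sZ); rewrite (ricciE AE).
set v := endo phi Y x; set w := endo phi Z x; set vw := met g (endo phi Y) (endo phi Z) x.
(* By u = u P + eta(u) xi, flatness evaluates A on u P as a multiple of P Q P minus a rank-one
   matrix; the rest is the rank-one matrix of u -> eta(u) (xi A). *)
have EA : A = c *: (vw *: (P x *m Q *m P x)
    - P x *m (g x *m w^T) *m (v *m Q *m P x)) + eta x *m (xi x *m A).
  apply: mulmx_row_inj => u; have [X [sX Xx]] := vfield_at x u.
  pose X' := \- endo phi X.
  have X'x : endo phi X' x = u *m P x by rewrite horizontalE -Xx.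
  have := flat_curvature QE (smooth_vfieldN (sphi sX)) sY sZ.
  rewrite -/X' (AE _ (sphi (smooth_vfieldN (sphi sX)))) -/c -/v -/w -/vw X'x.
  move=> uPA.
  have -> : u *m A = u *m P x *m A + form_at eta x u *: (xi x *m A).
    by rewrite mul_horizontal mulmxBl -scalemxAl subrK.
  rewrite uPA [RHS]mulmxDr -[X in _ = X + _]scalemxAr [X in _ = _ *: X + _]mulmxBr.
  rewrite -[X in _ = _ *: (X - _) + _]scalemxAr !mulmxA.
  congr (_ *: (_ - _) + _).
    transitivity ((u *m P x *m g x *m w^T) *m (v *m Q *m P x)).
      by rewrite [X in _ = X *m _]mx11_scalar mul_scalar_mx /met X'x.
    by rewrite !mulmxA.
  by rewrite [u *m eta x]mx11_scalar mul_scalar_mx scalemxAl.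
(* With V = phi Y and W = phi Z: g(R(xi, V) W, xi) = - g(W, R(xi, V) xi) = g(W, V). *)
have xi_part : met_at g x (xi x *m A) (xi x) = vw.
  rewrite -(AE _ sxi).
  apply: etrans (met_curvatureC gP LC x sxi (sphi sY) (sphi sZ) sxi) _.
  rewrite /met (curvature_xi_endo_xi hS LC x sY) met_atNr opprK.
  exact: (met_atC gP).
have w0 : form_at eta x w = 0 by exact: (acm_eta_phi acm).
rewrite EA !mxtraceD mxtraceZ mxtraceD mxtraceZ raddfN /=; congr (_ * (_ - _) + _).
- rewrite mxtrace_mulC /mxtrace big_ord1 -(met_horizontal (v *m Q) w0).
  by rewrite -[in RHS]horizontal_sq /met_at !mulmxA.
- by rewrite mxtrace_mulC /mxtrace big_ord1 -xi_part (acm_eta_dual acm).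
Qed.

Lemma met_at_eq0 x u : met_at g x u u = 0 -> u = 0.
Proof.
move=> u0; apply/eqP; apply/negP => /negP un; have [_ _ /(_ x u un)] := gP.
by rewrite u0 ltxx.
Qed.

Lemma ricci_operator_horizontal x (Q : 'M[R]_((2 * n).+1)) :
  (forall X, smooth_vfield X -> ricci_operator g nabla X x = X x *m Q) ->
  phi x *m Q *m P x = (2 * n)%:R *: phi x.
Proof.
move=> QE; set N : R := (2 * n)%:R; pose t := \tr (P x *m Q *m P x).
have N0 : 0 < N by rewrite ltr0n muln_gt0 /= n_gt0.
have Nn0 : N != 0 by rewrite lt0r_neq0.
(* The solution of k = (t - k) / N + 1, which is the trace identity divided by g(phi Y, phi Z). *)
pose k := (N^-1 * t + 1) / (1 + N^-1).
have kN : k * (1 + N^-1) = N^-1 * t + 1.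
  by rewrite divfK // lt0r_neq0 // addr_gt0 // invr_gt0.
have solve_k r s : r = N^-1 * (s * t - r) + s -> r = k * s.
  move=> E; have N1 : 1 + N^-1 != 0 by rewrite lt0r_neq0 // addr_gt0 // invr_gt0.
  by apply: (mulIf N1); rewrite mulrAC kN mulrDr mulr1 {1}E; ring.
have met_k Y Z : smooth_vfield Y -> smooth_vfield Z ->
    met_at g x (endo phi Y x *m Q) (endo phi Z x) =
    k * met_at g x (endo phi Y x) (endo phi Z x).
  by move=> sY sZ; apply: solve_k; exact: ricci_horizontal_trace.
have phiQP : phi x *m Q *m P x = k *: phi x.
  apply: mulmx_row_inj => u; have [Y [sY Yx]] := vfield_at x u.
  have -> : u *m (phi x *m Q *m P x) = endo phi Y x *m Q *m P x.
    by rewrite /endo Yx /endo_at !mulmxA.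
  rewrite -scalemxAr -[u *m phi x]/(endo_at phi x u) -Yx -/(endo phi Y x).
  apply/eqP; rewrite -subr_eq0; apply/eqP; set d := _ - _.
  have dP : d *m P x = d.
    rewrite /d [LHS]mulmxBl -(mulmxA (endo phi Y x *m Q)) horizontal_sq.
    by rewrite -scalemxAl endo_horizontal.
  (* The difference d is horizontal, so it is itself a value phi Z; testing against this Z gives
     g(d, d) = 0. *)
  have [Z [sZ Zx]] := vfield_at x (- endo_at phi x d).
  have Zd : endo phi Z x = d by rewrite /endo Zx -horizontalE.
  have d0 : form_at eta x d = 0 by rewrite -Zd (acm_eta_phi acm).
  apply: (met_at_eq0 (x := x)); rewrite {1}/d met_atDl met_atNl met_atZl.
  by rewrite (met_horizontal _ d0) -{1}Zd (met_k Y Z sY sZ) Zd subrr.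
suff -> : N = k by [].
have tk : t = k * N.
  have PE : P x = - (phi x *m phi x) by rewrite phi_sq opprK.
  rewrite /t {1}PE !mulNmx -!mulmxA [phi x *m (Q *m _)]mulmxA phiQP -scalemxAr.
  by rewrite phi_sq scalerN opprK mxtraceZ trace_horizontal.
apply/eqP; rewrite -subr_eq0.
(* With t = k N the equation for k reads k + k / N = k + 1. *)
have : k * N^-1 = 1.
  by have := kN; rewrite tk mulrCA mulVf // mulr1 mulrDr mulr1 => /addrI.
by move=> /(canRL (mulfVK Nn0)) ->; rewrite mul1r subrr.
Qed.

Lemma horizontal_curvature X Y Z x :
  smooth_vfield X -> smooth_vfield Y -> smooth_vfield Z ->
  curvature nabla (endo phi X) (endo phi Y) (endo phi Z) x =
  met g (endo phi Y) (endo phi Z) x *: endo phi X x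
  - met g (endo phi X) (endo phi Z) x *: endo phi Y x.
Proof.
move=> sX sY sZ; have [Q QE] := ricci_operator_mx gP LC x.
have H W : endo phi W x *m Q *m P x = (2 * n)%:R *: endo phi W x.
  rewrite /endo /endo_at scalemxAr -(ricci_operator_horizontal QE).
  by rewrite !mulmxA.
rewrite (flat_curvature QE sX sY sZ) !H scalerBr !scalerA.
by rewrite !(mulrCA (2 * n)%:R^-1) !mulVf ?double_n_neq0 // !mulr1.
Qed.

(** Put V = phi Y and V' = phi V. Constant curvature 1 makes phi R(V, V') a difference of two
    rank-one maps, each contributing g(V', V') = g(V, V) to the trace; the factor 1/2 in S* absorbs
    the doubling. *)
Lemma star_ricci_horizontal Y x : smooth_vfield Y ->
  star_ricci nabla phi (endo phi Y) (endo phi Y) x =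
  met g (endo phi Y) (endo phi Y) x.
Proof.
move=> sY; set v := endo phi Y x; set v' := endo phi (endo phi Y) x.
have [A AE] := curvature_mx3 LC x (sphi sY) (sphi (sphi sY)).
(* R(V, V') kills xi, so A is determined by its values on projected vectors u P. *)
have xiA : xi x *m A = 0.
  by rewrite -(AE _ sxi); exact: (curvature_endo_endo_xi hS LC x sY (sphi sY)).
have v'v' : met_at g x v' v' = met_at g x v v.
  by rewrite (acm_compat acm) (acm_eta_phi acm) mul0r subr0.
have v'v : met_at g x (v' *m phi x) v = - met_at g x v' v'.
  have E : met_at g x v' v' = - met_at g x (v' *m phi x) v := acm_skew acm x v' v.
  by rewrite E opprK.
have tr_rank1 u w : \tr (P x *m (g x *m u^T) *m (w *m phi x)) = met_at g x (w *m phi x) u.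
  rewrite mxtrace_mulC /mxtrace big_ord1 (mulmxA (w *m phi x)) -(mulmxA w).
  rewrite phi_horizontal.
  by rewrite /met_at !mulmxA.
have E : A *m phi x = P x *m (g x *m v'^T) *m (v *m phi x)
    - P x *m (g x *m v^T) *m (v' *m phi x).
  apply: mulmx_row_inj => u; have [X [sX Xx]] := vfield_at x u.
  pose X' := \- endo phi X; have sX' := smooth_vfieldN (sphi sX).
  have X'x : endo phi X' x = u *m P x by rewrite horizontalE -Xx.
  have := horizontal_curvature x sY (sphi sY) sX'.
  rewrite (AE _ (sphi sX')) -/X' X'x -/v -/v' /met X'x -/v -/v' => uPA.
  have uA : u *m A = u *m P x *m A.
    by rewrite mul_horizontal mulmxBl -scalemxAl xiA scaler0 subr0.
  rewrite [LHS]mulmxA uA uPA (met_atC gP x v') (met_atC gP x v).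
  rewrite [LHS]mulmxBl -!scalemxAl [RHS]mulmxBr; congr (_ - _).
    transitivity ((u *m P x *m g x *m v'^T) *m (v *m phi x)).
      by rewrite [X in _ = X *m _]mx11_scalar mul_scalar_mx.
    by rewrite !mulmxA.
  transitivity ((u *m P x *m g x *m v^T) *m (v' *m phi x)).
    by rewrite [X in _ = X *m _]mx11_scalar mul_scalar_mx.
  by rewrite !mulmxA.
rewrite /star_ricci (trace_fieldE (A := A *m phi x)); last first.
  by move=> Z sZ; rewrite mulmxA -(AE Z sZ).
rewrite E raddfB /= !tr_rank1 v'v -[v *m phi x]/v' v'v' opprK /met -/v.
by generalize_met; intros; lra.
Qed.

(** Since phi xi = 0, the second argument of the curvature is the zero field, written as 0 times
    itself so that tensoriality applies. *)
Lemma star_ricci_xi x : star_ricci nabla phi xi xi x = 0.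
Proof.
rewrite /star_ricci (trace_fieldE (A := 0)); first by rewrite mxtrace0 mulr0.
move=> Z sZ; rewrite mulmx0 (endo_xi hS).
have s0 := @smooth_vfield0 R _ M.
have -> : (fun _ => 0) = scalef (cst 0) (fun _ => 0) :> vfield M.
  by apply/funext => y; rewrite /scalef scaler0.
rewrite /endo (curvatureC LC x sxi (smooth_vfieldZc 0 s0) sZ).
rewrite (curvatureZl LC x (smooth_fun_cst 0) s0 sxi sZ).
by rewrite scale0r oppr0 /endo_at mul0mx.
Qed.

Lemma lie_metric_xi X Y x : smooth_vfield X -> smooth_vfield Y ->
  lie_metric g xi X Y x = 0.
Proof.
move=> sX sY; rewrite /lie_metric (xi_killing hS LC x sX sY).
by generalize_vfield (met g); intros; ring.
Qed.

(** If all values of phi vanished at x, then P = - phi^2 would be 0, against tr P = 2n > 0. *)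
Lemma horizontal_vector x : exists Y, smooth_vfield Y /\ endo phi Y x != 0.
Proof.
apply/not_existsP => H; have : P x = 0.
  apply: mulmx_row_inj => u; rewrite mulmx0 horizontalE.
  have [Y [sY Yx]] := vfield_at x (- endo_at phi x u); rewrite -Yx.
  by apply/eqP/negPn/negP => Y0; apply: (H Y); split.
move=> /(congr1 mxtrace); rewrite trace_horizontal mxtrace0 => /eqP.
by rewrite (negbTE double_n_neq0).
Qed.

End ProjectivelyFlat.

Theorem theorem4p10 (R : realType) (n : nat) (M : manifold R (2 * n).+1)
  (phi : M -> 'M[R]_((2 * n).+1)) (xi : vfield M) (eta : M -> 'cV[R]_((2 * n).+1))
  (g : M -> 'M[R]_((2 * n).+1)) (nabla : vfield M -> vfield M -> vfield M)
  (lambda mu : R) (p : M -> R)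
  (h_sasakian : sasakian phi xi eta g)
  (h_nabla : levi_civita g nabla)
  (h_flat : phi_projectively_flat phi g nabla)
  (h_soliton : star_conformal_eta_ricci_soliton phi xi eta g nabla lambda mu p) :
  mu = 1 /\
  forall x : M, lambda = 2^-1 * (p x + 2 / (2 * n + 1)%:R) - 1.
Proof.
have acm := h_sasakian.1.1; have sxi := acm_xi_smooth acm.
pose c x := 2 * lambda - (p x + 2 / (2 * n + 1)%:R).
have c2 x : c x = - 2.
  have [Y [sY Y0]] := horizontal_vector h_sasakian x.
  have sV : smooth_vfield (endo phi Y) := acm_phi_smooth acm sY.
  have := h_soliton.2 _ _ sV sV x.
  rewrite (lie_metric_xi h_sasakian h_nabla x sV sV) -/(c x).
  rewrite (star_ricci_horizontal h_sasakian h_nabla h_flat x sY).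
  have -> : form eta (endo phi Y) x = 0 := acm_eta_phi acm x (Y x).
  (* For V = phi Y the soliton equation is (2 + c x) g(V, V) = 0, and g(V, V) > 0. *)
  rewrite !mulr0 add0r addr0 -mulrDl => /eqP.
  have [_ _ pos] := acm_metric acm; rewrite mulf_eq0 (gt_eqF (pos x _ Y0)) orbF.
  by rewrite addrC addr_eq0 => /eqP.
split=> [|x]; last by have := c2 x; rewrite /c; lra.
have [x _] := acm_nonempty acm; have := h_soliton.2 _ _ sxi sxi x.
rewrite (lie_metric_xi h_sasakian h_nabla x sxi sxi) -/(c x) c2.
rewrite (star_ricci_xi h_sasakian h_nabla x) (met_xi_xi h_sasakian) /form.
(* At xi, where g(xi, xi) = eta(xi) = 1, the equation is -2 + 2 mu = 0. *)
by rewrite (acm_eta_xi acm) /=; lra.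
Qed.
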